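(* Let $H,K\in M_n(\mathbb{C})$ be Hermitian and let $r>0$. Then for every real $t$ with $t\le 0$ or $t\ge 1$ and every unitarily invariant norm $|||\cdot|||$ on $M_n(\mathbb{C})$, $$\big|\big|\big|e^{(1-t)H+tK}\big|\big|\big|\le \big|\big|\big|\left(e^{rH}\#_t e^{rK}\right)^{1/r}\big|\big|\big|.$$
   Context: For positive definite $X,Y\in M_n(\mathbb{C})$ and any $t\in\mathbb{R}$, the weighted geometric mean is $X\#_tY:=X^{1/2}(X^{-1/2}YX^{-1/2})^tX^{1/2}$, where real powers of positive definite matrices are defined by functional calculus; $X\#_tY$ is positive definite. A norm $|||\cdot|||$ on $M_n(\mathbb{C})$ is unitarily invariant if $|||UAV|||=|||A|||$ for all $A$ and all unitaries $U,V$. *)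

(* Defs.v *)
From mathcomp Require Import ssreflect ssrfun ssrbool eqtype ssrnat fintype bigop.
From Stdlib Require Import Reals ClassicalEpsilon.

Set Implicit Arguments.
Unset Strict Implicit.

Local Open Scope R_scope.

Record C := mkC { Cre : R; Cim : R }.
Definition C0 : C := mkC 0 0.
Definition C1 : C := mkC 1 0.
Definition RtoC (x : R) : C := mkC x 0.
Definition Cadd (a b : C) : C := mkC (Cre a + Cre b) (Cim a + Cim b).
Definition Cmul (a b : C) : C :=
  mkC (Cre a * Cre b - Cim a * Cim b) (Cre a * Cim b + Cim a * Cre b).
Definition Cconj (a : C) : C := mkC (Cre a) (- Cim a).
Definition Cmod (a : C) : R := sqrt (Cre a ^ 2 + Cim a ^ 2).

Definition Mat (n : nat) := 'I_n -> 'I_n -> C.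

Definition madd {n} (A B : Mat n) : Mat n := fun i j => Cadd (A i j) (B i j).
Definition cscale {n} (c : C) (A : Mat n) : Mat n := fun i j => Cmul c (A i j).
Definition mscale {n} (x : R) (A : Mat n) : Mat n := cscale (RtoC x) A.
Definition mmul {n} (A B : Mat n) : Mat n :=
  fun i j => \big[Cadd/C0]_(k < n) Cmul (A i k) (B k j).
Definition adj {n} (A : Mat n) : Mat n := fun i j => Cconj (A j i).
Definition mid {n} : Mat n := fun i j => if i == j then C1 else C0.
Definition mzero {n} : Mat n := fun _ _ => C0.
Definition mdiag {n} (d : 'I_n -> R) : Mat n :=
  fun i j => if i == j then RtoC (d i) else C0.

Definition hermitian {n} (A : Mat n) : Prop := adj A = A.
Definition unitary {n} (U : Mat n) : Prop := mmul (adj U) U = mid.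

Definition spectral_decomp {n} (A : Mat n) (p : Mat n * ('I_n -> R)) : Prop :=
  unitary p.1 /\ A = mmul (mmul p.1 (mdiag p.2)) (adj p.1).

Definition some_decomp {n} (A : Mat n) : Mat n * ('I_n -> R) :=
  epsilon (inhabits (mid, fun _ => 0)) (spectral_decomp A).

Definition mfun {n} (f : R -> R) (A : Mat n) : Mat n :=
  let p := some_decomp A in
  mmul (mmul p.1 (mdiag (fun i => f (p.2 i)))) (adj p.1).

(* matrix exponential of a Hermitian matrix, and real powers of a
   positive definite matrix *)
Definition mexp {n} (A : Mat n) : Mat n := mfun exp A.
Definition mpow {n} (A : Mat n) (s : R) : Mat n := mfun (fun x => Rpower x s) A.

Definition gmean {n} (X Y : Mat n) (t : R) : Mat n :=
  mmul (mmul (mpow X (1/2))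
             (mpow (mmul (mmul (mpow X (-(1/2))) Y) (mpow X (-(1/2)))) t))
       (mpow X (1/2)).

Definition is_norm {n} (N : Mat n -> R) : Prop :=
  (forall A, 0 <= N A) /\
  (forall A, N A = 0 -> A = mzero) /\
  (forall c A, N (cscale c A) = Cmod c * N A) /\
  (forall A B, N (madd A B) <= N A + N B).

Definition unitarily_invariant_norm {n} (N : Mat n -> R) : Prop :=
  is_norm N /\
  (forall A U V, unitary U -> unitary V -> N (mmul (mmul U A) V) = N A).

(* Main.v *)
(** Let [A], [B] be positive definite, [s >= 0], [G = A^(1/2) B A^(1/2)] and
    [P = A^(1/2) G^s A^(1/2)].  If [P <= lam], Loewner-Heinz yields
    [B^(s/(1+s)) <= lam^(1/(1+s)) A^-1], and taking logarithms
    [s ln B + (1+s) ln A <= ln lam].  Applying this to the [k]-th exterior powers of [A]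
    and [B] shows that the sum of the [k] largest eigenvalues of [s ln B + (1+s) ln A] is
    at most that of [ln P]; weak majorization of the logarithms then gives the inequality
    for all unitarily invariant norms.  The theorem is the case [A = e^(rH)],
    [B = e^(-rK)], [s = -t] for [t <= 0], and [A = e^(rK)], [B = e^(-rH)], [s = t - 1] for
    [t >= 1], because [X #_t Y = Y #_(1-t) X]. *)
From Stdlib Require Import Reals.
From HB Require Import structures.
From mathcomp Require Import all_boot all_order all_algebra all_fingroup.
From mathcomp Require Import spectral sesquilinear.
From mathcomp Require Import complex.
From mathcomp Require Import Rstruct.
From Stdlib Require Import ClassicalEpsilon FunctionalExtensionality.
From mathcomp Require Import ring lra.
Require Import Defs.
Set Implicit Arguments.
Unset Strict Implicit.
Unset Printing Implicit Defensive.
Import Order.TTheory GRing.Theory Num.Theory.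
Local Open Scope ring_scope.
Local Open Scope sesquilinear_scope.
Local Open Scope complex_scope.

(* Otherwise the arguments of type [R] would be parsed with Stdlib's operations. *)
#[local] Bind Scope ring_scope with R.

Local Notation CC := (R[i]).
Local Notation Re := (@complex.Re R).
Local Notation Im := (@complex.Im R).

(** * Functional calculus of Hermitian matrices *)

(** A bound [P <= lam] sees only the largest eigenvalue. The passage to all partial sums works
    because [P] is built from [A] and [B] by products and real powers alone, which exterior powers
    respect, while the logarithm of an exterior power is a derivation, with sums of eigenvalues as
    its spectrum. The exterior power is taken as the compression of the [k]-fold tensor power to the
    antisymmetric tensors: there products, powers and logarithms reduce to diagonal tensors, and the
    functional calculus passes to an invariant subspace. Loewner-Heinz is obtained without integral
    representations: an inner product estimate shows that the admissible exponents are closed under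
    midpoints, and continuity does the rest. The logarithm enters as the derivative of [y^x] at
    [x = 0]. Weak majorization is enough at the end because the exponential is both increasing and
    convex. The number [r] merely rescales logarithms. *)

Lemma adjM m n p (A : 'M[CC]_(m, n)) (B : 'M[CC]_(n, p)) :
  (A *m B)^t* = B^t* *m A^t*.
Proof. by rewrite trmx_mul map_mxM. Qed.

Lemma adjD m n (A B : 'M[CC]_(m, n)) : (A + B)^t* = A^t* + B^t*.
Proof. by apply/matrixP => i j; rewrite !mxE rmorphD. Qed.

Lemma adj1 n : (1%:M : 'M[CC]_n)^t* = 1%:M.
Proof. by rewrite trmx1 map_mx1. Qed.

Lemma ReD (x y : CC) : Re (x + y) = Re x + Re y.
Proof. by case: x; case: y. Qed.

Lemma ReM (a : R) (x : CC) : Re (a%:C * x) = a * Re x.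
Proof. by case: x => x y /=; rewrite mul0r subr0. Qed.

Lemma Re_sum (I : Type) (r : seq I) (P : pred I) (F : I -> CC) :
  Re (\sum_(i <- r | P i) F i) = \sum_(i <- r | P i) Re (F i).
Proof. exact: (big_morph _ ReD). Qed.

Definition qf n (v : 'rV[CC]_n) (A : 'M[CC]_n) : R := Re ((v *m A *m v^t*) 0 0).

(* The Loewner order; vectors are rows, with [qf v A] the real part of [v A v^*]. *)
Definition lemx n (A B : 'M[CC]_n) := forall v, qf v A <= qf v B.

Definition nsq (x : CC) : R := Re x ^+ 2 + Im x ^+ 2.

Lemma nsq_ge0 x : 0 <= nsq x.
Proof. by rewrite addr_ge0 ?sqr_ge0. Qed.

Lemma nsq_eq0 x : nsq x = 0 -> x = 0.
Proof.
move=> /eqP; rewrite paddr_eq0 ?sqr_ge0// !sqrf_eq0 => /andP[/eqP a /eqP b].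
by case: x a b => a b /= -> ->.
Qed.

Lemma qfD n (v : 'rV[CC]_n) A B : qf v (A + B) = qf v A + qf v B.
Proof. by rewrite /qf mulmxDr mulmxDl mxE ReD. Qed.

Lemma qfZ n (v : 'rV[CC]_n) (a : R) A : qf v (a%:C *: A) = a * qf v A.
Proof. by rewrite /qf -scalemxAr -scalemxAl mxE ReM. Qed.

Lemma qf_conj m n (v : 'rV[CC]_m) (X : 'M[CC]_(m, n)) A :
  qf v (X *m A *m X^t*) = qf (v *m X) A.
Proof. by rewrite /qf adjM !mulmxA. Qed.

Definition dg n (d : 'I_n -> R) : 'M[CC]_n := diag_mx (\row_i (d i)%:C).

Lemma dgE n (d : 'I_n -> R) i j : dg d i j = (d i)%:C *+ (i == j).
Proof. by rewrite !mxE. Qed.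

Lemma mul_dgl m n (d : 'I_m -> R) (X : 'M[CC]_(m, n)) i j :
  (dg d *m X) i j = (d i)%:C * X i j.
Proof. by rewrite mul_diag_mx !mxE. Qed.

Lemma mul_dgr m n (d : 'I_n -> R) (X : 'M[CC]_(m, n)) i j :
  (X *m dg d) i j = X i j * (d j)%:C.
Proof. by rewrite mul_mx_diag !mxE. Qed.

Lemma Re_sandwich (x : CC) (d : R) : Re (x * d%:C * (x^*)%C) = nsq x * d.
Proof.
have h (a b e : R) : (a * e - b * 0) * a - (a * 0 + b * e) * (- b) = (a ^+ 2 + b ^+ 2) * e.
  by ring.
by case: x => a b; exact: h.
Qed.

Lemma qf_dg n (v : 'rV[CC]_n) d : qf v (dg d) = \sum_i nsq (v 0 i) * d i.
Proof.
rewrite /qf mxE Re_sum; apply: eq_bigr => i _.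
by rewrite mul_dgr !mxE Re_sandwich.
Qed.

Lemma dg_adj n (d : 'I_n -> R) : (dg d)^t* = dg d.
Proof.
apply/matrixP => i j; rewrite mxE mxE !dgE eq_sym.
case: eqP => [->|_]; rewrite ?mulr1n ?mulr0n ?rmorph0 //.
exact: conjc_real.
Qed.

Lemma dg1 n : dg (fun _ : 'I_n => 1) = 1%:M.
Proof. by apply/matrixP => i j; rewrite dgE mxE. Qed.

Lemma dgM n (d e : 'I_n -> R) : dg d *m dg e = dg (fun i => d i * e i).
Proof.
apply/matrixP => i j; rewrite mul_dgl !dgE rmorphM.
by case: eqP => [->|]; rewrite ?mulr1n ?mulr0n ?mulr0.
Qed.

HB.lock Definition hspec n (d : 'I_n -> R) (P : 'M[CC]_n) := P^t* *m dg d *m P.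

Lemma unitaryK n (P : 'M[CC]_n) : P \is unitarymx -> P^t* *m P = 1%:M.
Proof. by move/unitarymxP/mulmx1C. Qed.

Lemma eq_hspec n (d e : 'I_n -> R) P : d =1 e -> hspec d P = hspec e P.
Proof.
move=> de; suff h : dg d = dg e by rewrite hspec.unlock h.
by apply/matrixP => i j; rewrite !dgE de.
Qed.

Lemma hspecM n (d e : 'I_n -> R) (P : 'M[CC]_n) : P \is unitarymx ->
  hspec d P *m hspec e P = hspec (fun i => d i * e i) P.
Proof.
move=> uP; by rewrite hspec.unlock -dgM !mulmxA -(mulmxA _ P (P^t*)) (unitarymxP uP) mulmx1.
Qed.

Lemma hspec1 n (P : 'M[CC]_n) : P \is unitarymx -> hspec (fun=> 1) P = 1%:M.
Proof. by move=> uP; rewrite hspec.unlock dg1 mulmx1 unitaryK. Qed.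

Lemma hspecZ n (a : R) (d : 'I_n -> R) (P : 'M[CC]_n) :
  a%:C *: hspec d P = hspec (fun i => a * d i) P.
Proof.
rewrite hspec.unlock; have <- : a%:C *: dg d = dg (fun i => a * d i).
  by apply/matrixP => i j; rewrite mxE !dgE rmorphM mulrnAr.
by rewrite -scalemxAr -scalemxAl.
Qed.

Lemma hspec_adj n (d : 'I_n -> R) (P : 'M[CC]_n) : (hspec d P)^t* = hspec d P.
Proof. by rewrite hspec.unlock !adjM trmxCK dg_adj mulmxA. Qed.

Lemma qf_hspec n (v : 'rV[CC]_n) d P :
  qf v (hspec d P) = \sum_i nsq ((v *m P^t*) 0 i) * d i.
Proof. by rewrite hspec.unlock -{2}[P]trmxCK qf_conj qf_dg. Qed.

Lemma qf1 n (v : 'rV[CC]_n) : qf v 1%:M = \sum_i nsq (v 0 i).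
Proof. by rewrite -dg1 qf_dg; apply: eq_bigr => i _; rewrite mulr1. Qed.

Lemma qf1_ge0 n (v : 'rV[CC]_n) : 0 <= qf v 1%:M.
Proof. by rewrite qf1 sumr_ge0 // => i _; apply: nsq_ge0. Qed.

Lemma qf1_gt0 n (v : 'rV[CC]_n) : v != 0 -> 0 < qf v 1%:M.
Proof.
move=> v0; rewrite lt_neqAle qf1_ge0 andbT; apply: contra_neq v0 => /esym/eqP.
rewrite qf1 psumr_eq0 => [|i _]; last exact: nsq_ge0.
by move=> /allP h; apply/rowP => i; rewrite mxE; apply/nsq_eq0/eqP/h/mem_index_enum.
Qed.

Definition herm n (A : 'M[CC]_n) := A^t* = A.

(** The value is diagonal in the orthonormal basis [spectralmx A] for every square [A], so
    identities between functions of one matrix carry no hypothesis on [A]. *)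
HB.lock Definition fc n (f : R -> R) (A : 'M[CC]_n) :=
  hspec (fun i => f (Re (spectral_diag A 0 i))) (spectralmx A).

Lemma herm_fc n (A : 'M[CC]_n) f : herm (fc f A).
Proof. by rewrite fc.unlock; exact: hspec_adj. Qed.

Lemma herm_spec n (A : 'M[CC]_n) : herm A ->
  A = hspec (fun i => Re (spectral_diag A 0 i)) (spectralmx A).
Proof.
move=> hA; have hs : A \is hermsymmx.
  apply/is_hermitianmxP; rewrite expr0 scale1r; exact: esym hA.
have /orthomx_spectralP AE := hermitian_normalmx hs.
have h : diag_mx (spectral_diag A) = dg (fun i => Re (spectral_diag A 0 i)).
  apply/matrixP => i j; rewrite dgE mxE RRe_real //.
  by have /mxOverP := hermitian_spectral_diag_real hs; apply.
by rewrite hspec.unlock -h -(invmx_unitary (spectral_unitarymx A)).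
Qed.

(* Specialised to commuting matrices, to [X X^*] and [X^* X], or to an isometry [X] onto an
   invariant subspace, this carries the whole functional calculus. *)
Lemma hspec_intertwine m n (d : 'I_m -> R) (e : 'I_n -> R) P Q
    (X : 'M[CC]_(m, n)) (f : R -> R) :
  P \is unitarymx -> Q \is unitarymx ->
  hspec d P *m X = X *m hspec e Q ->
  hspec (fun i => f (d i)) P *m X = X *m hspec (fun i => f (e i)) Q.
Proof.
move=> uP uQ h.
have hY : dg d *m (P *m X *m Q^t*) = P *m X *m Q^t* *m dg e.
  have := congr1 (fun Z => P *m Z *m Q^t*) h.
  rewrite hspec.unlock !mulmxA (unitarymxP uP) mul1mx.
  by rewrite -(mulmxA _ Q (Q^t*)) (unitarymxP uQ) mulmx1.
(* Entrywise, [hY] says [d i = e j] wherever the entry is nonzero, hence also [f (d i) = f (e j)]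
   there. *)
have hf : dg (f \o d) *m (P *m X *m Q^t*) = P *m X *m Q^t* *m dg (f \o e).
  apply/matrixP => i j; have /matrixP /(_ i j) := hY.
  rewrite !mul_dgl !mul_dgr.
  case: (eqVneq ((P *m X *m Q^t*) i j) 0) => [->|y0]; first by rewrite !mulr0 !mul0r.
  by rewrite mulrC => /(mulfI y0) /complexI /= ->; rewrite mulrC.
have := congr1 (fun Z => P^t* *m Z *m Q) hf.
rewrite hspec.unlock !mulmxA (unitaryK uP) mul1mx -(mulmxA _ (Q^t*) Q) (unitaryK uQ) mulmx1.
by move=> ->.
Qed.

(** Independence of the chosen diagonalisation: the identity matrix intertwines the given one with
    that of [spectralmx]. *)
Lemma fcE n f (d : 'I_n -> R) P : P \is unitarymx ->
  fc f (hspec d P) = hspec (fun i => f (d i)) P.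
Proof.
move=> uP; have hd := herm_spec (hspec_adj d P).
have := @hspec_intertwine n n _ d _ P 1%:M f (spectral_unitarymx (hspec d P)) uP.
move=> /(_ (fun i => Re (spectral_diag (hspec d P) 0 i))).
by rewrite -hd !mulmx1 !mul1mx fc.unlock => h; exact: h.
Qed.

Lemma fc_intertwine m n f (A : 'M[CC]_m) (B : 'M[CC]_n) (X : 'M[CC]_(m, n)) :
  herm A -> herm B -> A *m X = X *m B -> fc f A *m X = X *m fc f B.
Proof.
move=> /herm_spec hA /herm_spec hB AB; rewrite fc.unlock; apply: hspec_intertwine.
- exact: spectral_unitarymx.
- exact: spectral_unitarymx.
- by rewrite -hA -hB.
Qed.

Definition posdef n (A : 'M[CC]_n) := herm A /\ forall v, v != 0 -> 0 < qf v A.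

Lemma posdef_hspec n (d : 'I_n -> R) P : P \is unitarymx ->
  (forall i, 0 < d i) -> posdef (hspec d P).
Proof.
move=> uP dp; split=> [|v v0]; first exact: hspec_adj.
rewrite qf_hspec; have w0 : v *m P^t* != 0.
  apply: contra_neq v0 => h.
  by rewrite -[v]mulmx1 -(unitaryK uP) mulmxA h mul0mx.
have := qf1_gt0 w0; rewrite qf1 => s0.
rewrite lt_neqAle sumr_ge0 => [|i _]; last by rewrite mulr_ge0 ?nsq_ge0 // ltW.
rewrite andbT eq_sym psumr_eq0 => [|i _]; last by rewrite mulr_ge0 ?nsq_ge0 // ltW.
apply: contraTN s0 => /allP h; rewrite big1 ?ltxx // => i _.
have := h i (mem_index_enum _); rewrite mulf_eq0 (gt_eqF (dp i)) orbF.
by move/eqP.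
Qed.

Lemma row_hspec n (d : 'I_n -> R) P i : P \is unitarymx ->
  row i P *m hspec d P = (d i)%:C *: row i P.
Proof.
move=> uP; rewrite hspec.unlock !mulmxA -!row_mul (unitarymxP uP) mul1mx.
by apply/rowP => j; rewrite [LHS]mxE mul_dgl !mxE.
Qed.

Lemma row_unitary_neq0 n (P : 'M[CC]_n) i : P \is unitarymx -> row i P != 0.
Proof.
move=> uP; apply/eqP => h; have /matrixP/(_ i i) := unitarymxP uP.
have <- : (row i P *m P^t*) 0 i = (P *m P^t*) i i by rewrite -row_mul [LHS]mxE.
by rewrite h mul0mx !mxE eqxx => /eqP; rewrite eq_sym oner_eq0.
Qed.

Lemma qf_row_hspec n (d : 'I_n -> R) P i : P \is unitarymx ->
  qf (row i P) (hspec d P) = d i * qf (row i P) 1%:M.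
Proof. by move=> uP; rewrite /qf row_hspec // -scalemxAl mxE ReM mulmx1. Qed.

Lemma posdef_hspec_gt0 n (d : 'I_n -> R) P i : P \is unitarymx ->
  posdef (hspec d P) -> 0 < d i.
Proof.
move=> uP [_ pA]; have v0 := row_unitary_neq0 i uP.
have := pA _ v0; rewrite qf_row_hspec // pmulr_lgt0 //.
exact: qf1_gt0.
Qed.

Lemma posdefP n (A : 'M[CC]_n) : posdef A ->
  exists d P, [/\ P \is unitarymx, forall i, 0 < d i & A = hspec d P].
Proof.
move=> pA; have AE := herm_spec pA.1; have uP := spectral_unitarymx A.
exists (fun i => Re (spectral_diag A 0 i)), (spectralmx A); split=> // i.
by rewrite AE in pA; exact: (posdef_hspec_gt0 i uP pA).
Qed.

Lemma fcP n (A : 'M[CC]_n) : exists d P,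
  P \is unitarymx /\ forall f, fc f A = hspec (fun i => f (d i)) P.
Proof.
exists (fun i => Re (spectral_diag A 0 i)), (spectralmx A).
by rewrite fc.unlock; split; [exact: spectral_unitarymx | move=> f].
Qed.

(** [Rpower x y] is [exp (y * ln x)], positive for every real [x]; hence powers are positive
    definite and add their exponents for any [A], while [pw A 1 = A] needs positivity. *)
Definition pw n (A : 'M[CC]_n) (x : R) := fc (fun y => Rpower y x) A.

Lemma Rpower_gt0 x y : 0 < Rpower x y.
Proof. exact/RltP/exp_pos. Qed.

Lemma posdef_pw n (A : 'M[CC]_n) x : posdef (pw A x).
Proof.
have [d [P [uP E]]] := fcP A; rewrite /pw E.
by apply: (posdef_hspec uP) => i; exact: Rpower_gt0.
Qed.

Lemma pwD n (A : 'M[CC]_n) x y : pw A x *m pw A y = pw A (x + y).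
Proof.
have [d [P [uP E]]] := fcP A; rewrite /pw !E (hspecM _ _ uP); apply: eq_hspec => i.
by rewrite -RmultE -Rpower_plus.
Qed.

Lemma pw0 n (A : 'M[CC]_n) : pw A 0 = 1%:M.
Proof.
have [d [P [uP E]]] := fcP A; rewrite /pw !E -(hspec1 uP); apply: eq_hspec => i.
by rewrite /Rpower Rmult_0_l exp_0.
Qed.

Lemma pw1 n (A : 'M[CC]_n) : posdef A -> pw A 1 = A.
Proof.
move=> /posdefP[d [P [uP dp ->]]]; rewrite /pw (fcE _ _ uP); apply: eq_hspec => i.
by rewrite Rpower_1 //; apply/RltP.
Qed.

Lemma fc_comp n (A : 'M[CC]_n) f g : fc g (fc f A) = fc (fun x => g (f x)) A.
Proof. by have [d [P [uP E]]] := fcP A; rewrite !E (fcE _ _ uP). Qed.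

Lemma eq_fc_pos n (A : 'M[CC]_n) f g : posdef A -> (forall x, 0 < x -> f x = g x) ->
  fc f A = fc g A.
Proof.
move=> /posdefP[d [P [uP dp ->]]] fg; rewrite !(fcE _ _ uP).
by apply: eq_hspec => i; rewrite fg.
Qed.

Lemma pw_pw n (A : 'M[CC]_n) x y : pw (pw A x) y = pw A (x * y).
Proof.
have [d [P [uP E]]] := fcP A; rewrite /pw fc_comp !E.
by apply: eq_hspec => i; rewrite Rpower_mult.
Qed.

Lemma herm_pw n (A : 'M[CC]_n) x : herm (pw A x).
Proof. exact: herm_fc. Qed.

Lemma pwK n (A : 'M[CC]_n) x : pw A x *m pw A (- x) = 1%:M.
Proof. by rewrite pwD -(pw0 A) addrN. Qed.

Lemma pwVK n (A : 'M[CC]_n) x : pw A (- x) *m pw A x = 1%:M.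
Proof. by rewrite pwD -(pw0 A) addNr. Qed.

(** The right inverse makes [v *m X] nonzero. [X] may be rectangular, so this covers compressions as
    well as conjugation by powers. *)
Lemma posdef_conj m n (A : 'M[CC]_m) (X : 'M[CC]_(n, m)) (Y : 'M[CC]_(m, n)) :
  X *m Y = 1%:M -> posdef A -> posdef (X *m A *m X^t*).
Proof.
move=> XY [hA pA]; split=> [|v v0]; first by rewrite /herm !adjM trmxCK hA mulmxA.
rewrite qf_conj; apply: pA; apply: contra_neq v0 => h.
by rewrite -[v]mulmx1 -XY mulmxA h mul0mx.
Qed.

Lemma posdef_pw_conj n (A B : 'M[CC]_n) x : posdef A -> posdef (pw B x *m A *m pw B x).
Proof.
by move=> pA; rewrite -{2}(herm_pw B x); apply: (posdef_conj (pwK B x)).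
Qed.

Lemma fcZ n (A : 'M[CC]_n) c f : fc (fun x => c * f x) A = c%:C *: fc f A.
Proof. by have [d [P [uP E]]] := fcP A; rewrite !E hspecZ. Qed.

Lemma hspecD n (d e : 'I_n -> R) (P : 'M[CC]_n) :
  hspec (fun i => d i + e i) P = hspec d P + hspec e P.
Proof.
rewrite hspec.unlock (_ : dg (fun i => d i + e i) = dg d + dg e) ?mulmxDr ?mulmxDl //.
by apply/matrixP => i j; rewrite [RHS]mxE !dgE rmorphD mulrnDl.
Qed.

Lemma fcD n (A : 'M[CC]_n) f g : fc (fun x => f x + g x) A = fc f A + fc g A.
Proof. by have [d [P [uP E]]] := fcP A; rewrite !E hspecD. Qed.

Lemma fc_cst n (A : 'M[CC]_n) c : fc (fun=> c) A = c%:C *: 1%:M.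
Proof.
have [d [P [uP E]]] := fcP A; rewrite E -(hspec1 uP) hspecZ.
by apply: eq_hspec => i; rewrite mulr1.
Qed.

Lemma fc_posdef n (A : 'M[CC]_n) f : posdef A -> (forall x, 0 < x -> 0 < f x) ->
  posdef (fc f A).
Proof.
move=> /posdefP[d [P [uP dp ->]]] fp; rewrite (fcE _ _ uP).
by apply: (posdef_hspec uP) => i; exact: fp.
Qed.

(** * Inner products and the midpoint step for powers *)

Definition ip n (x y : 'rV[CC]_n) : R := Re ((x *m y^t*) 0 0).

Lemma ipC n (x y : 'rV[CC]_n) : ip x y = ip y x.
Proof.
rewrite /ip -{1}[x]trmxCK -adjM [LHS]/= !mxE.
by case: (\sum_j _) => a b.
Qed.

Lemma ipDl n (x y z : 'rV[CC]_n) : ip (x + y) z = ip x z + ip y z.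
Proof. by rewrite /ip mulmxDl mxE ReD. Qed.

Lemma ipZl n c (x y : 'rV[CC]_n) : ip (c%:C *: x) y = c * ip x y.
Proof. by rewrite /ip -scalemxAl mxE ReM. Qed.

Lemma ip_adj m n (x : 'rV[CC]_m) (M : 'M_(m, n)) y : ip (x *m M) y = ip x (y *m M^t*).
Proof. by rewrite /ip adjM trmxCK mulmxA. Qed.

Lemma ip_pwC n (x y : 'rV[CC]_n) A a : ip (x *m pw A a) y = ip x (y *m pw A a).
Proof. by rewrite ip_adj herm_pw. Qed.

(** Expansion of [|x - c y|^2 >= 0]; with a suitable [c] it does the work of Cauchy-Schwarz without
    square roots. *)
Lemma ip_sqrB n c (x y : 'rV[CC]_n) : 2 * c * ip x y <= ip x x + c ^+ 2 * ip y y.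
Proof.
have : 0 <= ip (x + (- c)%:C *: y) (x + (- c)%:C *: y).
  by have := qf1_ge0 (x + (- c)%:C *: y); rewrite /qf mulmx1.
rewrite ipDl ipZl (ipC x) (ipC y (_ + _)) !ipDl !ipZl (ipC y x); nra.
Qed.

Lemma qf1E n (v : 'rV[CC]_n) : qf v 1%:M = ip v v.
Proof. by rewrite /qf mulmx1. Qed.

Lemma qf_pw_conj n (v : 'rV[CC]_n) A B x : qf (v *m pw A x) B = qf v (pw A x *m B *m pw A x).
Proof. by rewrite -{3}(herm_pw A x) qf_conj. Qed.

Lemma qf_pwD n (v : 'rV[CC]_n) A x y :
  qf (v *m pw A x) (pw A y) = qf v (pw A (x + y + x)).
Proof. by rewrite qf_pw_conj !pwD. Qed.

Lemma ip_pw n (v : 'rV[CC]_n) A x : ip (v *m pw A x) (v *m pw A x) = qf v (pw A (x + x)).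
Proof. by rewrite -qf1E -(pw0 A) qf_pwD addr0. Qed.

Lemma row_pwK n (v : 'rV[CC]_n) A x : v *m pw A x *m pw A (- x) = v.
Proof. by rewrite -mulmxA pwK mulmx1. Qed.

Lemma row_pwVK n (v : 'rV[CC]_n) A x : v *m pw A (- x) *m pw A x = v.
Proof. by rewrite -mulmxA pwVK mulmx1. Qed.

Lemma hspec_le1 n (d : 'I_n -> R) P : P \is unitarymx -> (forall i, d i <= 1) ->
  lemx (hspec d P) 1%:M.
Proof.
move=> uP d1 v; rewrite -(hspec1 uP) !qf_hspec; apply: ler_sum => i _.
by rewrite ler_wpM2l // nsq_ge0.
Qed.

(** The bounds combine to [2 d^2 q <= (1 + d^2) q], which fails for [d > 1]. *)
Lemma le1_of_sqr (d y q w : R) : 0 < q -> y <= q -> w <= q ->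
  2 * d * (d * q) <= y + d ^+ 2 * w -> d <= 1.
Proof.
move=> q0 yq wq h; rewrite leNgt; apply/negP => d1.
have d2 : 1 < d ^+ 2 by rewrite exprn_egt1.
have h1 : d ^+ 2 * w <= d ^+ 2 * q by rewrite ler_wpM2l ?sqr_ge0.
have h2 : q < d ^+ 2 * q by rewrite ltr_pMl.
move: h h1 h2; rewrite mulrA -(mulrA 2) -expr2; move: (d ^+ 2) => e; lra.
Qed.

(* An eigenvalue of [X^-h Y^(a+b) X^-h], where [2h = a+b], is an eigenvalue of the
   product of the contractions [X^-b Y^b] and [Y^a X^-a], up to similarity. *)
Lemma pw_le_mid n (X Y : 'M[CC]_n) a b :
  lemx (pw Y (a + a)) (pw X (a + a)) -> lemx (pw Y (b + b)) (pw X (b + b)) ->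
  lemx (pw Y (a + b)) (pw X (a + b)).
Proof.
move=> ha hb; pose h := (a + b) / 2.
have hh : h + h = a + b by rewrite /h; lra.
have /posdefP[d [P [uP dp TE]]] := posdef_pw_conj X (- h) (posdef_pw Y (a + b)).
have d1 i : d i <= 1.
  pose u := row i P; pose z := u *m pw X (- h).
  have u0 : u != 0 := row_unitary_neq0 i uP.
  have zE : z *m pw Y (a + b) = (d i)%:C *: (z *m pw X (a + b)).
    have uT : u *m (pw X (- h) *m pw Y (a + b) *m pw X (- h)) = (d i)%:C *: u.
      by rewrite TE; exact: row_hspec.
    have e : z *m pw Y (a + b) *m pw X (- h) = (d i)%:C *: u.
      by rewrite -uT /z !mulmxA.
    rewrite -(row_pwVK (z *m pw Y (a + b)) X h) e -scalemxAl; congr (_ *: _).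
    by rewrite /z -mulmxA pwD; congr (_ *m pw _ _); lra.
  (* From [z Y^(a+b) = d z X^(a+b)] one gets [d |q|^2 = <y, w>] with [w = q X^-a Y^a]. The
     hypothesis for [b] at [z] gives [|y| <= |q|], and that for [a] at [q X^-a] gives
     [|w| <= |q|]. *)
  pose y := z *m pw Y b; pose q := z *m pw X b.
  have q0 : q != 0.
    apply: contra_neq u0 => h0; rewrite -(row_pwVK u X h) -/z -(row_pwK z X b) -/q h0.
    by rewrite !mul0mx.
  have yq : y *m pw Y a *m pw X (- a) = (d i)%:C *: q.
    rewrite /y -(mulmxA z) pwD [b + a]addrC zE -scalemxAl -mulmxA pwD.
    by congr (_ *: (_ *m pw _ _)); lra.
  have le1 : ip y y <= ip q q by rewrite /y /q !ip_pw.
  pose w := q *m pw X (- a) *m pw Y a.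
  have le2 : ip w w <= ip q q.
    rewrite /w ip_pw; apply: (le_trans (ha _)).
    by rewrite qf_pwD (_ : - a + (a + a) + - a = 0) ?pw0 ?qf1E; [exact: lexx | ring].
  have yw : ip y w = d i * ip q q.
    by rewrite -ipZl -yq !ip_pwC.
  have q1 : 0 < ip q q by rewrite -qf1E; exact: qf1_gt0.
  have := ip_sqrB (d i) y w; rewrite yw; exact: le1_of_sqr q1 le1 le2.
move=> v; have := hspec_le1 uP d1 (v *m pw X h); rewrite -TE.
by rewrite -!qf_pw_conj row_pwK -(pw0 X) qf_pwD addr0 hh.
Qed.

(** * Operator monotonicity of powers and logarithm *)

(* Bisection: a closed set containing [0] and [1] and closed under midpoints. *)
Lemma closed_midpoint (S : R -> Prop) : S 0 -> S 1 ->
  (forall a b, S a -> S b -> S ((a + b) / 2)) ->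
  (forall x : R, (forall e : R, 0 < e -> exists2 y, S y & `|y - x| < e) -> S x) ->
  forall x : R, 0 <= x <= 1 -> S x.
Proof.
move=> S0 S1 Smid Scl x /andP[x0 x1].
have bis k : exists a b, [/\ S a, S b, a <= x, x <= b & b - a = 2^-1 ^+ k].
  elim: k => [|k [a [b [Sa Sb ax xb ab]]]].
    by exists 0, 1; split=> //; rewrite subr0.
  case: (leP x ((a + b) / 2)) => h.
    exists a, ((a + b) / 2); split; [exact: Sa|exact: Smid|exact: ax|exact: h|].
    by rewrite exprS -ab; field.
  exists ((a + b) / 2), b; split; [exact: Smid|exact: Sb|exact: ltW|exact: xb|].
  by rewrite exprS -ab; field.
apply: Scl => e e0.
have [k hk] : exists k, (2^-1 : R) ^+ k < e.
  have /RltP h2 : Rabs (2^-1) < 1 by rewrite RabsE ger0_norm; lra.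
  have /RltP e0' := e0.
  have [k /(_ k (le_n k))] := pow_lt_1_zero (2^-1) h2 e e0'.
  rewrite RpowE => /RltP; rewrite RabsE ger0_norm; last first.
    by apply: exprn_ge0; rewrite invr_ge0; exact: ler0n.
  by exists k.
have [a [b [Sa Sb ax xb ab]]] := bis k.
exists a => //; rewrite ler0_norm; lra.
Qed.

Lemma derivable_pt_lim_bigsum n (F : 'I_n -> R -> R) (l : 'I_n -> R) x :
  (forall i, derivable_pt_lim (F i) x (l i)) ->
  derivable_pt_lim (fun y => \sum_i F i y) x (\sum_i l i).
Proof.
move=> h; elim: (index_enum _) => [|i r IH].
  rewrite big_nil; apply: (derivable_pt_lim_ext (fun=> 0)).
    by move=> y; rewrite big_nil.
  exact: derivable_pt_lim_const.
rewrite big_cons; apply: (derivable_pt_lim_ext (fun y => F i y + \sum_(j <- r) F j y)).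
  by move=> y; rewrite big_cons.
exact: derivable_pt_lim_plus.
Qed.

Lemma derivable_pt_lim_Rpower_exponent y x :
  derivable_pt_lim (fun t => Rpower y t) x (Rpower y x * ln y).
Proof.
have := derivable_pt_lim_comp _ exp x _ _
  (derivable_pt_lim_scal id (ln y) x 1 (derivable_pt_lim_id x)) (derivable_pt_lim_exp _).
rewrite Rmult_1_r /mult_real_fct /= [Rmult (ln y) _]Rmult_comm.
apply: derivable_pt_lim_ext => t; rewrite /comp /Rpower; congr exp; exact: Rmult_comm.
Qed.

Lemma derivable_pt_lim_qf_pw n (v : 'rV[CC]_n) A x :
  derivable_pt_lim (fun t => qf v (pw A t)) x
    (qf v (fc (fun y => Rpower y x * ln y) A)).
Proof.
have [d [P [uP E]]] := fcP A; rewrite E qf_hspec.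
apply: (derivable_pt_lim_ext
  (fun t => \sum_i nsq ((v *m P^t*) 0 i) * Rpower (d i) t)).
  by move=> t; rewrite /pw E qf_hspec.
apply: derivable_pt_lim_bigsum => i.
exact: (derivable_pt_lim_scal (Rpower (d i)) (nsq ((v *m P^t*) 0 i)) x _
  (derivable_pt_lim_Rpower_exponent (d i) x)).
Qed.

(** Used twice: for continuity in the exponent in [loewner_heinz], and at [x = 0], where the
    derivative is a difference of logarithms, in [fc_ln_le]. *)
Lemma derivable_pt_lim_qf_pwB n (v : 'rV[CC]_n) A B x :
  derivable_pt_lim (fun t => qf v (pw A t) - qf v (pw B t)) x
    (qf v (fc (fun y => Rpower y x * ln y) A) - qf v (fc (fun y => Rpower y x * ln y) B)).
Proof.
exact: (derivable_pt_lim_minus _ _ _ _ _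
  (derivable_pt_lim_qf_pw v A x) (derivable_pt_lim_qf_pw v B x)).
Qed.

Lemma continuity_pt_lt0 f (x : R) : continuity_pt f x -> f x < 0 ->
  exists2 d : R, 0 < d & forall y : R, `|y - x| < d -> f y < 0.
Proof.
move=> fc f0; have /RltP e0 : 0 < - f x by rewrite oppr_gt0.
have [d [/RltP d0 hd]] := fc _ e0; exists d => // y yd.
case: (eqVneq y x) => [->//|/eqP yx].
have /RltP : Rlt (R_dist (f y) (f x)) (- f x).
  apply: hd; split; first by split=> // /esym.
  by apply/RltP; rewrite /= /Rdist RabsE.
by rewrite /R_dist RabsE ltr_norml => /andP[_]; rewrite ltrBlDl subrr.
Qed.

(** The exponents that preserve [Y <= X] contain [0] and [1], are closed under midpoints by
    [pw_le_mid], and form a closed set by continuity. *)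
Theorem loewner_heinz n (X Y : 'M[CC]_n) (x : R) : posdef X -> posdef Y -> lemx Y X ->
  0 <= x <= 1 -> lemx (pw Y x) (pw X x).
Proof.
move=> pX pY YX; apply: (@closed_midpoint (fun x => lemx (pw Y x) (pw X x))).
- by move=> v; rewrite !pw0; exact: lexx.
- by rewrite !pw1.
- move=> a b; have half (c : R) : c = c / 2 + c / 2 by field.
  rewrite {1 2}(half a) {1 2}(half b) mulrDl; exact: pw_le_mid.
- move=> {}x hx v; rewrite leNgt; apply/negP => lt.
  have h := derivable_pt_lim_qf_pwB v X Y x.
  have c := derivable_continuous_pt _ _ (exist _ _ h).
  have f0 : qf v (pw X x) - qf v (pw Y x) < 0 by rewrite subr_lt0.
  have [d d0 hd] := continuity_pt_lt0 c f0.
  by have [y /(_ v) Sy /hd] := hx _ d0; rewrite subr_lt0 ltNge Sy.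
Qed.

Lemma derivable_pt_lim_ge0 (f : R -> R) l : derivable_pt_lim f 0 l -> f 0 = 0 ->
  (forall x, 0 <= x <= 1 -> 0 <= f x) -> 0 <= l.
Proof.
move=> fl f0 fp; rewrite leNgt; apply/negP => l0.
have /RltP l0' : 0 < - l by rewrite oppr_gt0.
have [[d /RltP /= d0] hd] := fl _ l0'.
(* Small enough for the difference quotient to be close to [l], and inside [[0, 1]], where [f] is
   known to be nonnegative. *)
pose y := Order.min (d / 2) 1.
have y0 : 0 < y by rewrite lt_min ltr01 andbT divr_gt0.
have y1 : y <= 1 by rewrite ge_min lexx orbT.
have yd : y < d by rewrite gt_min ltr_pdivrMr ?ltr_pMr //; lra.
have yn0 : y <> 0 by apply/eqP; rewrite gt_eqF.
have /RltP yd' : Rabs y < d by rewrite RabsE gtr0_norm.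
have /RltP := hd y yn0 yd'; rewrite RabsE f0 Rplus_0_l Rminus_0_r RdivE RminusE.
have fy : 0 <= f y by apply: fp; rewrite (ltW y0) y1.
have q0 : 0 <= f y / y := divr_ge0 fy (ltW y0).
rewrite ltr_norml => /andP[_].
by rewrite ltrBlDr addNr ltNge q0.
Qed.

(** The difference of the forms of [X^x] and [Y^x] vanishes at [x = 0] and is nonnegative on
    [[0, 1]], so its derivative at [0] is nonnegative. *)
Theorem fc_ln_le n (X Y : 'M[CC]_n) : posdef X -> posdef Y -> lemx Y X ->
  lemx (fc ln Y) (fc ln X).
Proof.
move=> pX pY YX v; rewrite -subr_ge0.
have h0 A : fc (fun y => Rpower y 0 * ln y) A = fc ln A :> 'M[CC]_n.
  have [d [P [uP E]]] := fcP A; rewrite !E; apply: eq_hspec => i.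
  by rewrite /Rpower Rmult_0_l exp_0 mul1r.
have := derivable_pt_lim_qf_pwB v X Y 0; rewrite !h0 => /derivable_pt_lim_ge0; apply.
  by rewrite !pw0 subrr.
by move=> x x01; rewrite subr_ge0; exact: loewner_heinz.
Qed.

Lemma le_of_double (p q r : R) : 2 * q <= p + r -> r <= q -> q <= p.
Proof. by lra. Qed.

(** With [w = v X^-1], the square inequality gives [2 <v, w> <= v Y^-1 v^* + w Y w^*]. Here
    [<v, w> = v X^-1 v^*], and [w Y w^* <= w X w^*] is at most the same number. *)
Lemma pwN1_le n (X Y : 'M[CC]_n) : posdef X -> posdef Y -> lemx Y X ->
  lemx (pw X (- 1)) (pw Y (- 1)).
Proof.
move=> pX pY YX v; pose w := v *m pw X (- 1).
have h : - 1 = - (2^-1) + - (2^-1) :> R by field.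
have := ip_sqrB 1 (v *m pw Y (- (2^-1))) (w *m pw Y 2^-1).
rewrite ip_pwC -(mulmxA w) pwK mulmx1 !ip_pw -h expr1n mul1r mulr1.
have -> : 2^-1 + 2^-1 = 1 :> R by field.
rewrite (pw1 pY) => le1.
have le2 : qf w Y <= qf v (pw X (- 1)).
  apply: (le_trans (YX w)); rewrite -[X in qf w X](pw1 pX) /w qf_pwD.
  by rewrite (_ : - 1 + 1 + - 1 = - 1); [exact: lexx | ring].
have e : ip v w = qf v (pw X (- 1)) by rewrite ipC.
by rewrite e in le1; exact: (le_of_double le1 le2).
Qed.

(* [A #_(-s) B^-1] *)
Definition renyi n (A B : 'M[CC]_n) s :=
  pw A 2^-1 *m pw (pw A 2^-1 *m B *m pw A 2^-1) s *m pw A 2^-1.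

Lemma halfDhalf : 2^-1 + 2^-1 = 1 :> R.
Proof. by field. Qed.

Lemma ln_RpowerE x y : ln (Rpower x y) = y * ln x.
Proof. by rewrite /Rpower ln_exp. Qed.

Lemma ln_mulr x y : 0 < x -> 0 < y -> ln (x * y) = ln x + ln y.
Proof. by move=> /RltP x0 /RltP y0; exact: ln_mult. Qed.

Lemma Rpower_Mdistr (x y z : R) : 0 < x -> 0 < y ->
  Rpower (x * y) z = Rpower x z * Rpower y z.
Proof. by move=> /RltP x0 /RltP y0; rewrite -Rpower_mult_distr. Qed.

Lemma Rpower_N1 (x : R) : 0 < x -> Rpower x (- 1) = x^-1.
Proof. by move=> /RltP x0; rewrite Rpower_Ropp Rpower_1. Qed.

Lemma Rpower_inv (x y : R) : 0 < x -> Rpower x^-1 y = (Rpower x y)^-1.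
Proof.
move=> x0; rewrite -Rpower_N1 // Rpower_mult Rmult_comm -Rpower_mult.
by rewrite Rpower_N1 ?Rpower_gt0.
Qed.

(** Multiplication by [1 + s], since [(1 + s) (1 - p) = s]. *)
Lemma log_combine (s p L a b c : R) : 0 < 1 + s -> (1 + s) * p = 1 ->
  (1 - p) * b <= p * L * c + - 1 * a -> s * b + (1 + s) * a <= L * c.
Proof.
move=> s1 sp; rewrite -(ler_pM2l s1) !mulrDr mulrA mulrBr mulr1 !mulrA sp mul1r.
rewrite mulrN mulr1 mulNr; lra.
Qed.

(* With [G = A^(1/2) B A^(1/2)], the hypothesis reads [G^s <= lam A^-1].  Conjugation by
   [G^(1/2)] and Loewner-Heinz give [(lam^-1)^p G <= E^p] for [E = G^(1/2) A^-1 G^(1/2)]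
   and [p = 1/(1+s)].  As [B = X X^*] and [E = X^* X] with [X = A^(-1/2) G^(1/2)], this
   says [B^(1-p) = X E^-p X^* <= lam^p A^-1], and it remains to take logarithms. *)
Theorem renyi_le_log n (A B : 'M[CC]_n) (s lam : R) : posdef A -> posdef B ->
  0 <= s -> 0 < lam -> lemx (renyi A B s) (lam%:C *: 1%:M) ->
  lemx (s%:C *: fc ln B + (1 + s)%:C *: fc ln A) ((ln lam)%:C *: 1%:M).
Proof.
move=> pA pB s0 lam0 le0.
pose h : R := 2^-1.
pose G := pw A h *m B *m pw A h.
have pG : posdef G := posdef_pw_conj A h pB.
have hh : h + h = 1 := halfDhalf.
(* With this exponent the [p]-th power of [lam^-1 G^(1+s)] is a multiple of [G], and [s >= 0] keeps
   [p] within the range of Loewner-Heinz. *)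
pose p := (1 + s)^-1.
have s1 : 0 < 1 + s by lra.
have p0 : 0 < p by rewrite invr_gt0.
have p1 : p <= 1 by rewrite invf_le1 //; lra.
have le1 : lemx (pw G s) (lam%:C *: pw A (- 1)).
  move=> v; have := le0 (v *m pw A (- h)).
  rewrite /renyi -/h -/G -qf_pw_conj row_pwVK => /le_trans; apply.
  rewrite !qfZ -(pw0 A) qf_pwD.
  by rewrite (_ : - h + 0 + - h = - 1); [exact: lexx | rewrite -hh; ring].
pose E := pw G h *m pw A (- 1) *m pw G h.
have pE : posdef E := posdef_pw_conj G h (posdef_pw A (- 1)).
pose Y := fc (fun x => lam^-1 * Rpower x (1 + s)) G.
have li0 : 0 < lam^-1 by rewrite invr_gt0.
have pY : posdef Y.
  by apply: fc_posdef => // x x0; rewrite mulr_gt0 // Rpower_gt0.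
have le2 : lemx Y E.
  move=> v; rewrite /Y fcZ qfZ -/(pw G (1 + s)).
  have -> : 1 + s = h + s + h by rewrite -hh; ring.
  rewrite -qf_pwD /E -qf_pw_conj.
  by rewrite ler_pdivrMl //; have := le1 (v *m pw G h); rewrite qfZ.
have p01 : 0 <= p <= 1 by rewrite p1 ltW.
have le3 := loewner_heinz pE pY le2 p01.
pose k := Rpower lam p.
have k0 : 0 < k := Rpower_gt0 _ _.
have YE : pw Y p = fc (fun x => k^-1 * x) G.
  rewrite /pw /Y fc_comp; apply: eq_fc_pos => // x x0.
  rewrite Rpower_Mdistr ?Rpower_gt0 // Rpower_inv // Rpower_mult.
  have -> : Rmult (1 + s) p = 1 by rewrite RmultE /p divff // gt_eqF.
  by rewrite Rpower_1 //; exact/RltP.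
have le4 : lemx (pw E (- p)) (k%:C *: pw G (- 1)).
  have pYp : posdef (pw Y p) := posdef_pw Y p.
  move=> v; have := pwN1_le (posdef_pw E p) pYp le3 v.
  rewrite pw_pw mulrN mulr1 => /le_trans; apply.
  suff -> : pw (pw Y p) (- 1) = k%:C *: pw G (- 1) by exact: lexx.
  rewrite YE /pw fc_comp -fcZ; apply: eq_fc_pos => // x x0.
  by rewrite Rpower_Mdistr ?invr_gt0 // Rpower_N1 ?invr_gt0 // invrK.
pose X := pw A (- h) *m pw G h.
have XX : X *m X^t* = B.
  rewrite /X adjM !herm_pw !mulmxA -(mulmxA (pw A (- h))) pwD hh (pw1 pG) /G.
  by rewrite !mulmxA pwVK mul1mx -mulmxA pwK mulmx1.
have XtX : X^t* *m X = E.
  rewrite /X adjM !herm_pw !mulmxA -(mulmxA (pw G h)) pwD /E.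
  by congr (_ *m pw _ _ *m _); rewrite -hh; ring.
have BX : pw B (- p) *m X = X *m pw E (- p).
  by apply: fc_intertwine pB.1 pE.1 _; rewrite -XX -XtX !mulmxA.
have le5 : lemx (pw B (1 - p)) (k%:C *: pw A (- 1)).
  move=> v; have -> : pw B (1 - p) = X *m pw E (- p) *m X^t*.
    by rewrite -BX -mulmxA XX -[X in _ = _ *m X](pw1 pB) pwD addrC.
  rewrite qf_conj; apply: (le_trans (le4 _)); rewrite !qfZ.
  rewrite /X mulmxA qf_pwD (_ : h + - 1 + h = 0); last by rewrite -hh; ring.
  rewrite pw0 -(pw0 A) qf_pwD (_ : - h + 0 + - h = - 1); first exact: lexx.
  by rewrite -hh; ring.
move=> v.
(* This is [k A^-1], written as a function of [A] so that its logarithm [p ln lam - ln A] can be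
   read off. *)
pose Y2 := fc (fun x => k * Rpower x (- 1)) A.
have pY2 : posdef Y2.
  by apply: fc_posdef => // x x0; rewrite mulr_gt0 // Rpower_gt0.
have lnY : fc ln Y2 = (p * ln lam)%:C *: 1%:M + (- 1)%:C *: fc ln A.
  rewrite -(fc_cst A) -fcZ -fcD /Y2 fc_comp; apply: eq_fc_pos => // x x0.
  by rewrite ln_mulr ?Rpower_gt0 // !ln_RpowerE.
have lnB : fc ln (pw B (1 - p)) = (1 - p)%:C *: fc ln B.
  by rewrite -fcZ /pw fc_comp; apply: eq_fc_pos => // x x0; rewrite ln_RpowerE.
have le6 : lemx (pw B (1 - p)) Y2 by rewrite /Y2 fcZ.
have := fc_ln_le pY2 (posdef_pw B (1 - p)) le6 v.
rewrite lnY lnB !qfD !qfZ; apply: log_combine => //.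
by rewrite /p divff // gt_eqF.
Qed.

(** * Exterior powers *)

Local Notation idx k n := {ffun 'I_k -> 'I_n}.

Local Notation ival := (@enum_val (idx _ _) predT).

Lemma sum_idx (T : finType) (F : T -> CC) :
  \sum_(l < #|T|) F (enum_val l) = \sum_f F f.
Proof. by rewrite -(big_enum_val F). Qed.

(** The Kronecker product, with multi-indices numbered because matrix indices are ordinals. The
    factors may differ, as [tder] requires. *)
Definition tens k n (As : 'I_k -> 'M[CC]_n) : 'M[CC]_#|idx k n| :=
  \matrix_(i < #|idx k n|, j < #|idx k n|) \prod_a As a (ival i a) (ival j a).

Lemma eq_tens k n (As Bs : 'I_k -> 'M[CC]_n) : As =1 Bs -> tens As = tens Bs.
Proof. by move=> AB; apply/matrixP => i j; rewrite !mxE; apply: eq_bigr => a _; rewrite AB. Qed.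

Lemma tensM k n (As Bs : 'I_k -> 'M[CC]_n) :
  tens As *m tens Bs = tens (fun a => As a *m Bs a).
Proof.
apply/matrixP => i j; rewrite !mxE.
rewrite (eq_bigr (fun l => \prod_a (As a (ival i a) (ival l a) *
  Bs a (ival l a) (ival j a)))); last by move=> l _; rewrite !mxE big_split.
rewrite (sum_idx (fun f : idx k n => \prod_a (As a (ival i a) (f a) * Bs a (f a) (ival j a)))).
rewrite -(bigA_distr_bigA (fun a b => As a (ival i a) b * Bs a b (ival j a))).
by apply: eq_bigr => a _; rewrite mxE.
Qed.

Lemma prod_idx_eq k n (f g : idx k n) : \prod_a (f a == g a)%:R = (f == g)%:R :> CC.
Proof.
case: eqP => [->|/eqP fg]; first by rewrite big1 // => a _; rewrite eqxx.
have [a fga] : exists a, f a != g a.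
  apply/existsP; apply: contraNT fg; rewrite negb_exists => /forallP h.
  by apply/eqP/ffunP => a; apply/eqP; have := h a; rewrite negbK.
by rewrite (bigD1 a) //= (negbTE fga) mul0r.
Qed.

Lemma tens1 k n : tens (fun _ : 'I_k => 1%:M : 'M[CC]_n) = 1%:M.
Proof.
apply/matrixP => i j; rewrite !mxE; under eq_bigr => a _ do rewrite mxE.
by rewrite prod_idx_eq (inj_eq enum_val_inj).
Qed.

Lemma tens_adj k n (As : 'I_k -> 'M[CC]_n) : (tens As)^t* = tens (fun a => (As a)^t*).
Proof.
apply/matrixP => i j; rewrite !mxE rmorph_prod; apply: eq_bigr => a _.
by rewrite !mxE.
Qed.

Lemma tens_dg k n (d : 'I_k -> 'I_n -> R) :
  tens (fun a => dg (d a)) = dg (fun i : 'I_#|idx k n| => \prod_a d a (ival i a)).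
Proof.
apply/matrixP => i j; rewrite mxE dgE rmorph_prod -mulr_natr.
rewrite -(inj_eq enum_val_inj) -prod_idx_eq -big_split; apply: eq_bigr => a _ /=.
by rewrite dgE mulr_natr.
Qed.

Definition tpow k n (A : 'M[CC]_n) := tens (fun _ : 'I_k => A).

(* The derivative at [t = 0] of [tpow k e^(tL)]: the [k]-fold tensor power sends [e^L] to
   [e^(tder k L)]. *)
Definition tder k n (L : 'M[CC]_n) :=
  \sum_(a < k) tens (fun b : 'I_k => if b == a then L else 1%:M).

Lemma tpowM k n (A B : 'M[CC]_n) : tpow k A *m tpow k B = tpow k (A *m B).
Proof. exact: tensM. Qed.

Lemma tpow_unitary k n (P : 'M[CC]_n) : P \is unitarymx -> tpow k P \is unitarymx.
Proof.
by move=> /unitarymxP uP; apply/unitarymxP; rewrite tens_adj tpowM uP; exact: tens1.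
Qed.

Lemma tpow_hspec k n (d : 'I_n -> R) (P : 'M[CC]_n) :
  tpow k (hspec d P) = hspec (fun i : 'I_#|idx k n| => \prod_(a < k) d (ival i a)) (tpow k P).
Proof. by rewrite !hspec.unlock -(tens_dg (fun=> d)) tens_adj -!tpowM. Qed.

Lemma dg_sum m (I : Type) (r : seq I) (F : I -> 'I_m -> R) :
  dg (fun i => \sum_(a <- r) F a i) = \sum_(a <- r) dg (F a).
Proof.
apply/matrixP => i j; rewrite summxE dgE rmorph_sum.
by rewrite -sumrMnl; apply: eq_bigr => a _; rewrite dgE.
Qed.

(** [tpow k P] diagonalises all summands at once: in the factors other than [a] the identity is
    conjugated to itself. *)
Lemma tder_hspec k n (d : 'I_n -> R) (P : 'M[CC]_n) : P \is unitarymx ->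
  tder k (hspec d P) = hspec (fun i : 'I_#|idx k n| => \sum_(a < k) d (ival i a)) (tpow k P).
Proof.
move=> uP; rewrite hspec.unlock dg_sum mulmx_sumr mulmx_suml; apply: eq_bigr => a _.
have -> : dg (fun i : 'I_#|idx k n| => d (ival i a)) =
    tens (fun b : 'I_k => if b == a then dg d else 1%:M).
  rewrite (@eq_tens _ _ _ (fun b => dg (if b == a then d else fun=> 1))); last first.
    by move=> b; case: eqP => _; rewrite ?dg1.
  rewrite tens_dg; apply/matrixP => i j; rewrite !dgE; congr (_%:C *+ _).
  by rewrite (bigD1 a) //= eqxx big1 ?mulr1 // => b /negbTE ->.
rewrite tens_adj !tensM; apply: eq_tens => b.
by case: eqP => _; rewrite ?mulmx1 ?hspec.unlock ?unitaryK.
Qed.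

Lemma tder_entry k n (L : 'M[CC]_n) i j : tder k L i j =
  \sum_(a < k) L (ival i a) (ival j a) *
     \prod_(b < k | b != a) (ival i b == ival j b)%:R.
Proof.
rewrite summxE; apply: eq_bigr => a _; rewrite mxE (bigD1 a) //= eqxx.
by congr (_ * _); apply: eq_bigr => b /negbTE ->; rewrite mxE.
Qed.

Lemma tderD k n (A B : 'M[CC]_n) : tder k (A + B) = tder k A + tder k B.
Proof.
apply/matrixP => i j; rewrite [RHS]mxE !tder_entry -big_split; apply: eq_bigr => a _ /=.
by rewrite mxE mulrDl.
Qed.

Lemma tderZ k n c (A : 'M[CC]_n) : tder k (c *: A) = c *: tder k A.
Proof.
apply/matrixP => i j; rewrite [RHS]mxE !tder_entry mulr_sumr; apply: eq_bigr => a _ /=.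
by rewrite mxE mulrA.
Qed.

(** * Antisymmetric tensors and compression to them *)

Definition permidx k n (s : 'S_k) (i : 'I_#|idx k n|) : 'I_#|idx k n| :=
  enum_rank [ffun a => ival i (s a)].

Lemma permidxE k n (s : 'S_k) (i : 'I_#|idx k n|) a :
  ival (permidx s i) a = ival i (s a).
Proof. by rewrite enum_rankK ffunE. Qed.

Lemma permidx_inj k n (s : 'S_k) : injective (@permidx k n s).
Proof.
move=> i j /(congr1 enum_val)/ffunP h; apply: enum_val_inj; apply/ffunP => a.
by have := h (s^-1%g a); rewrite !permidxE permKV.
Qed.

(** Commutation with all permutations of the tensor factors, expressed on entries. *)
Definition equivariant k n (M : 'M[CC]_#|idx k n|) :=
  forall s i j, M (permidx s i) (permidx s j) = M i j.

Lemma tpow_equivariant k n (A : 'M[CC]_n) : equivariant (tpow k A).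
Proof.
move=> s i j; rewrite !mxE [RHS](reindex_inj (@perm_inj _ s)) /=.
by apply: eq_bigr => a _; rewrite !permidxE.
Qed.

Definition sgc k (s : 'S_k) : CC := (-1) ^+ s.

Definition antisym k n (x : 'rV[CC]_#|idx k n|) :=
  forall s i, x 0 (permidx s i) = sgc s * x 0 i.

Lemma antisym_mul k n (x : 'rV[CC]_#|idx k n|) M :
  antisym x -> equivariant M -> antisym (x *m M).
Proof.
move=> ax eM s j; rewrite !mxE (reindex_inj (@permidx_inj _ _ s)) mulr_sumr /=.
by apply: eq_bigr => i _; rewrite ax eM mulrA.
Qed.

Definition permmx k n (s : 'S_k) : 'M[CC]_#|idx k n| :=
  \matrix_(i, j) (i == permidx s j)%:R.

Lemma mul_permmx k n (s : 'S_k) (x : 'rV[CC]_#|idx k n|) j :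
  (x *m permmx n s) 0 j = x 0 (permidx s j).
Proof.
rewrite mxE (bigD1 (permidx s j)) //= !mxE eqxx mulr1 big1 ?addr0 // => i ij.
by rewrite mxE (negbTE ij) mulr0.
Qed.

(* Its row space consists of the antisymmetric tensors, that is, of the exterior power. *)
Definition antimx k n : 'M[CC]_#|idx k n| :=
  (\bigcap_(s : 'S_k) eigenspace (permmx n s) (sgc s))%MS.

Lemma antimxP k n (x : 'rV[CC]_#|idx k n|) : reflect (antisym x) (x <= antimx k n)%MS.
Proof.
apply: (iffP sub_bigcapmxP) => [h s i|ax s _].
  by have /eigenspaceP/rowP/(_ i) := h s isT; rewrite mul_permmx mxE.
by apply/eigenspaceP/rowP => i; rewrite mul_permmx mxE.
Qed.

Definition antibasis k n := schmidt (row_base (antimx k n)).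

Lemma antibasis_unitary k n : antibasis k n \is unitarymx.
Proof. by apply: schmidt_unitarymx; exact: rank_leq_col. Qed.

Lemma antibasis_eqmx k n : (antibasis k n :=: antimx k n)%MS.
Proof.
by apply: eqmx_trans (eqmx_schmidt_free (row_base_free _)) (eq_row_base _).
Qed.

Lemma antibasisK k n m (X : 'M[CC]_(m, _)) : (X <= antimx k n)%MS ->
  X *m (antibasis k n)^t* *m antibasis k n = X.
Proof.
rewrite -(antibasis_eqmx k n) => /submxP[Y ->].
by rewrite mulmxtVK // antibasis_unitary.
Qed.

Lemma antibasis_stable k n M : equivariant M -> (antibasis k n *m M <= antimx k n)%MS.
Proof.
move=> eM; apply/row_subP => i; rewrite row_mul; apply/antimxP/antisym_mul => //.
by apply/antimxP; rewrite -(antibasis_eqmx k n) row_sub.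
Qed.

(* Compression to the antisymmetric tensors, in an orthonormal basis of these. *)
Definition cmpr k n M := antibasis k n *m M *m (antibasis k n)^t*.

Lemma cmpr_antibasis k n M : equivariant M ->
  cmpr M *m antibasis k n = antibasis k n *m M.
Proof. by move=> eM; rewrite antibasisK // antibasis_stable. Qed.

Lemma cmprM k n (M N : 'M_#|idx k n|) : equivariant M -> cmpr M *m cmpr N = cmpr (M *m N).
Proof. by move=> eM; rewrite /cmpr !mulmxA cmpr_antibasis. Qed.

Lemma herm_cmpr k n (M : 'M_#|idx k n|) : herm M -> herm (cmpr M).
Proof. by move=> hM; rewrite /herm /cmpr !adjM trmxCK hM mulmxA. Qed.

(** [antibasis] intertwines [cmpr M] with [M], hence also their functions, and its rows are
    orthonormal. *)
Lemma fc_cmpr k n (M : 'M_#|idx k n|) f : herm M -> equivariant M ->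
  fc f (cmpr M) = cmpr (fc f M).
Proof.
move=> hM eM; rewrite /cmpr -(fc_intertwine _ (herm_cmpr hM) hM (cmpr_antibasis eM)).
by rewrite mulmxtVK // antibasis_unitary.
Qed.

Lemma qf_cmpr k n (M : 'M_#|idx k n|) v : qf v (cmpr M) = qf (v *m antibasis k n) M.
Proof. exact: qf_conj. Qed.

Lemma posdef_cmpr k n (M : 'M_#|idx k n|) : posdef M -> posdef (cmpr M).
Proof. by apply: posdef_conj; apply/unitarymxP; exact: antibasis_unitary. Qed.

Definition ext k n (A : 'M[CC]_n) := cmpr (tpow k A).

Lemma ext_mul k n (A B : 'M[CC]_n) : ext k A *m ext k B = ext k (A *m B).
Proof. by rewrite /ext cmprM ?tpowM //; exact: tpow_equivariant. Qed.

Lemma Rpower_prod (I : Type) (r : seq I) (F : I -> R) s : (forall i, 0 < F i) ->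
  Rpower (\prod_(i <- r) F i) s = \prod_(i <- r) Rpower (F i) s.
Proof.
move=> F0; elim: r => [|i r IH]; first by rewrite !big_nil /Rpower ln_1 Rmult_0_r exp_0.
by rewrite !big_cons Rpower_Mdistr ?IH //; apply: prodr_gt0.
Qed.

Lemma ln_prod (I : Type) (r : seq I) (F : I -> R) : (forall i, 0 < F i) ->
  ln (\prod_(i <- r) F i) = \sum_(i <- r) ln (F i).
Proof.
move=> F0; elim: r => [|i r IH]; first by rewrite !big_nil ln_1.
by rewrite !big_cons ln_mulr ?IH //; apply: prodr_gt0.
Qed.

Lemma prod_exp (I : Type) (r : seq I) (F : I -> R) :
  \prod_(i <- r) exp (F i) = exp (\sum_(i <- r) F i).
Proof.
elim: r => [|i r IH]; first by rewrite !big_nil exp_0.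
by rewrite !big_cons IH -RmultE -exp_plus.
Qed.

Lemma exp_ler (x y : R) : x <= y -> exp x <= exp y.
Proof.
by rewrite le_eqVlt => /predU1P[->//|/RltP/exp_increasing/RltP/ltW].
Qed.

Lemma posdef_tpow k n (A : 'M[CC]_n) : posdef A -> posdef (tpow k A).
Proof.
move=> /posdefP[d [P [uP dp ->]]]; rewrite tpow_hspec.
by apply: posdef_hspec => [|i]; [exact: tpow_unitary | exact: prodr_gt0].
Qed.

Lemma posdef_ext k n (A : 'M[CC]_n) : posdef A -> posdef (ext k A).
Proof. by move=> pA; exact/posdef_cmpr/posdef_tpow. Qed.

Lemma pw_ext k n (A : 'M[CC]_n) s : posdef A -> pw (ext k A) s = ext k (pw A s).
Proof.
move=> pA; rewrite /ext /pw (fc_cmpr _ (posdef_tpow k pA).1 (@tpow_equivariant _ _ _)).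
have [d [P [uP dp ->]]] := posdefP pA.
rewrite (fcE _ _ uP) !tpow_hspec (fcE _ _ (tpow_unitary k uP)); congr cmpr.
by apply: eq_hspec => i; exact: Rpower_prod.
Qed.

(** The eigenvalues of a tensor power are products over multi-indices; [ln] turns them into the sums
    that [tder] has as eigenvalues in the same basis. *)
Lemma fc_ln_ext k n (A : 'M[CC]_n) : posdef A ->
  fc ln (ext k A) = cmpr (tder k (fc ln A)).
Proof.
move=> pA; rewrite /ext (fc_cmpr _ (posdef_tpow k pA).1 (@tpow_equivariant _ _ _)).
have [d [P [uP dp ->]]] := posdefP pA.
rewrite (fcE _ _ uP) (tder_hspec _ _ uP) tpow_hspec (fcE _ _ (tpow_unitary k uP)).
by congr cmpr; apply: eq_hspec => i; exact: ln_prod.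
Qed.

Lemma renyi_ext k n (A B : 'M[CC]_n) s : posdef A -> posdef B ->
  renyi (ext k A) (ext k B) s = ext k (renyi A B s).
Proof.
move=> pA pB; rewrite /renyi !(pw_ext k _ pA) !ext_mul.
by rewrite (pw_ext k s (posdef_pw_conj A 2^-1 pB)) !ext_mul.
Qed.

Lemma sum_inj_le k n (f : 'I_k -> 'I_n) (b : 'I_n -> R) : injective f ->
  (forall i j : 'I_n, (i <= j)%N -> b j <= b i) ->
  \sum_a b (f a) <= \sum_(i < n | (i < k)%N) b i.
Proof.
move=> fI bI; case: k f fI => [|k] f fI.
  by rewrite big_ord0 big1 ?lexx.
have kn : (k < n)%N.
  by have := leq_card f fI; rewrite !card_ord.
(* The least of the first [k.+1] values. Both sums have [k.+1] terms, so [m] may be subtracted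
   throughout; then terms inside the range are nonnegative and those outside nonpositive. *)
pose m := b (Ordinal kn).
suff : \sum_a (b (f a) - m) <= \sum_(i < n | (i < k.+1)%N) (b i - m).
  by rewrite !(big_ord_narrow kn) !sumrB !sumr_const !card_ord lerD2r.
have -> : \sum_a (b (f a) - m) = \sum_(i in [set f a | a in 'I_k.+1]) (b i - m).
  by rewrite big_imset //= => a c _ _; exact: fI.
rewrite (bigID (fun i : 'I_n => (i < k.+1)%N)) /=.
rewrite [X in _ <= X](bigID (mem [set f a | a in 'I_k.+1])) /=.
apply: lerD.
  by rewrite le_eqVlt; apply/orP; left; apply/eqP/eq_bigl => i; rewrite andbC.
apply: (@le_trans _ _ 0).
  by apply: sumr_le0 => i /andP[_]; rewrite -leqNgt subr_le0 => ki; apply: bI; exact: ltnW.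
by apply: sumr_ge0 => i /andP[ki _]; rewrite subr_ge0; apply: bI.
Qed.

(** Transposing two places with equal entries fixes the multi-index but flips the sign. *)
Lemma antisym_noninj k n (x : 'rV[CC]_#|idx k n|) i :
  antisym x -> ~ injective (ival i) -> x 0 i = 0.
Proof.
move=> ax /injectiveP/injectivePn[a [c ac iac]].
have := ax (tperm a c) i; rewrite /sgc odd_tperm ac expr1 mulN1r.
have -> : permidx (tperm a c) i = i.
  apply: enum_val_inj; apply/ffunP => e; rewrite permidxE.
  by case: tpermP => // ->.
move=> /eqP; rewrite -addr_eq0 -mulr2n -mulr_natl mulf_eq0.
by rewrite pnatr_eq0 => /eqP.
Qed.

Lemma qf1_unitary m n (v : 'rV[CC]_m) (V : 'M[CC]_(m, n)) : V \is unitarymx ->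
  qf (v *m V) 1%:M = qf v 1%:M.
Proof. by move=> uV; rewrite -qf_conj mulmx1 (unitarymxP uV). Qed.

(** Antisymmetry removes the multi-indices with repetitions; on the injective ones the eigenvalue is
    the exponential of a sum of [k] distinct [b i]. *)
Lemma qf_ext_le k n (b : 'I_n -> R) (U : 'M[CC]_n) : U \is unitarymx ->
  (forall i j : 'I_n, (i <= j)%N -> b j <= b i) ->
  lemx (ext k (hspec (fun i => exp (b i)) U))
       ((exp (\sum_(i < n | (i < k)%N) b i))%:C *: 1%:M).
Proof.
move=> uU bI v; rewrite qf_cmpr tpow_hspec qf_hspec qfZ.
have -> : qf v 1%:M = \sum_i nsq ((v *m antibasis k n *m (tpow k U)^t*) 0 i) * 1.
  by rewrite -qf_hspec (hspec1 (tpow_unitary k uU)) (qf1_unitary _ (antibasis_unitary k n)).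
rewrite mulr_sumr; apply: ler_sum => i _; rewrite mulr1 mulrC.
case: (boolP (injectiveb (ival i))) => [/injectiveP ii|/injectiveP ii].
  rewrite ler_wpM2r ?nsq_ge0 //.
  by rewrite prod_exp; apply/exp_ler/sum_inj_le.
rewrite (antisym_noninj _ ii) /nsq /= ?expr0n /= ?addr0 ?mulr0 //.
apply: antisym_mul; last by rewrite tens_adj; exact: tpow_equivariant.
by apply/antimxP; rewrite -(antibasis_eqmx k n) submxMl.
Qed.

(* The exterior product of the first [k] basis vectors, whose coordinates are minors. *)
Lemma tder_eigenvector k n (a : 'I_n -> R) : (k <= n)%N ->
  exists2 x : 'rV[CC]_#|idx k n|, antisym x /\ x != 0 &
    x *m dg (fun i => \sum_c a (ival i c)) = (\sum_(i < n | (i < k)%N) a i)%:C *: x.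
Proof.
move=> kn; pose w := widen_ord kn.
have wI : injective w by move=> c e /(congr1 val) /= /val_inj.
pose M (i : 'I_#|idx k n|) : 'M[CC]_k := \matrix_(c, e) (ival i c == w e)%:R.
exists (\row_i \det (M i)); first split.
- move=> s i; rewrite !mxE.
  have -> : M (permidx s i) = row_perm s (M i).
    by apply/matrixP => c e; rewrite !mxE permidxE.
  by rewrite row_permE det_mulmx det_perm.
- apply/eqP => /rowP/(_ (enum_rank [ffun c => w c])); rewrite !mxE.
  have -> : M (enum_rank [ffun c => w c]) = 1%:M.
    apply/matrixP => c e; rewrite !mxE enum_rankK ffunE.
    by rewrite (inj_eq wI).
  by rewrite det1 => /eqP; rewrite oner_eq0.
apply/rowP => i; rewrite mul_dgr !mxE mulrC.
case: (eqVneq (\det (M i)) 0) => [->|d0]; first by rewrite !mulr0.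
congr (_%:C * _).
(* A nonzero minor forces [i] to be injective with values below [k], hence a permutation of the
   first [k] indices, so the eigenvalue does not depend on [i]. *)
have inj : injective (ival i).
  move=> c e ce; apply/eqP; apply: contraNT d0 => nce; apply/eqP.
  by apply: (determinant_alternate nce) => j; rewrite !mxE ce.
have im c : (ival i c < k)%N.
  rewrite ltnNge; apply: contraNN d0 => kc.
  rewrite (expand_det_row _ c) big1 // => e _; rewrite mxE.
  rewrite (_ : (_ == _) = false) ?mul0r //; apply/negbTE/eqP => h.
  by move: kc; rewrite h leqNgt /= ltn_ord.
pose g c := Ordinal (im c).
have gI : injective g by move=> c e [/val_inj/inj].
rewrite (big_ord_narrow kn).
rewrite [RHS](reindex_inj gI); apply: eq_bigr => c _; congr (a _).
by apply: val_inj.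
Qed.

Theorem renyi_log_majorization k n (A B U W : 'M[CC]_n) (s : R) (a b : 'I_n -> R) :
  posdef A -> posdef B -> 0 <= s -> (k <= n)%N ->
  U \is unitarymx -> renyi A B s = hspec (fun i => exp (b i)) U ->
  (forall i j : 'I_n, (i <= j)%N -> b j <= b i) ->
  W \is unitarymx -> s%:C *: fc ln B + (1 + s)%:C *: fc ln A = hspec a W ->
  \sum_(i < n | (i < k)%N) a i <= \sum_(i < n | (i < k)%N) b i.
Proof.
move=> pA pB s0 kn uU PE bI uW SE.
have pe := @qf_ext_le k n b U uU bI; rewrite -PE -renyi_ext // in pe.
have e0 : 0 < exp (\sum_(i < n | (i < k)%N) b i) by exact/RltP/exp_pos.
have := renyi_le_log (posdef_ext k pA) (posdef_ext k pB) s0 e0 pe.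
rewrite ln_exp !fc_ln_ext // => le.
have [x [ax x0] xE] := tder_eigenvector a kn.
(* The exterior product of the first [k] rows of [W], an eigenvector of [tder k (hspec a W)] for the
   sum of the first [k] values of [a]. Being antisymmetric, it survives the compression. *)
pose y := x *m tpow k W.
have yV : y *m (antibasis k n)^t* *m antibasis k n = y.
  by apply: antibasisK; apply/antimxP/antisym_mul => //; exact: tpow_equivariant.
have yy : qf (y *m (antibasis k n)^t*) 1%:M = qf x 1%:M.
  by rewrite -(qf1_unitary _ (antibasis_unitary k n)) yV qf1_unitary ?tpow_unitary.
have e M : qf (y *m (antibasis k n)^t*) (cmpr M) = qf y M by rewrite qf_cmpr yV.
have := le (y *m (antibasis k n)^t*); rewrite qfZ yy.
have -> : qf (y *m (antibasis k n)^t*) (s%:C *: cmpr (tder k (fc ln B)) +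
    (1 + s)%:C *: cmpr (tder k (fc ln A))) = qf y (tder k (hspec a W)).
  by rewrite -SE tderD !tderZ; rewrite qfD qfZ qfZ; rewrite qfD qfZ qfZ; rewrite e; rewrite e.
have xq : 0 < qf x 1%:M := qf1_gt0 x0.
have -> : qf y (tder k (hspec a W)) = (\sum_(i < n | (i < k)%N) a i) * qf x 1%:M.
  rewrite (tder_hspec _ _ uW) hspec.unlock -{2}[tpow k W]trmxCK qf_conj.
  rewrite /y -mulmxA (unitarymxP (tpow_unitary k uW)) mulmx1.
  by rewrite /qf xE -scalemxAl mxE ReM mulmx1.
by rewrite ler_pM2r.
Qed.

(** * Unitarily invariant norms and majorization *)

Lemma unitary_perm_mx n (s : 'S_n) : perm_mx s \is @unitarymx CC n n.
Proof.
apply/unitarymxP; rewrite tr_perm_mx map_perm_mx -perm_mxM mulgV.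
exact: perm_mx1.
Qed.

Lemma perm_mx_dg n (s : 'S_n) (d : 'I_n -> R) :
  perm_mx s *m dg d *m (perm_mx s)^t* = dg (fun i => d (s i)).
Proof.
rewrite tr_perm_mx map_perm_mx -row_permE -col_permE.
by apply/matrixP => i j; rewrite !mxE (inj_eq perm_inj).
Qed.

Lemma hspec_sorted n (d : 'I_n -> R) (P : 'M[CC]_n) : P \is unitarymx ->
  exists (s : 'S_n) Q, [/\ Q \is unitarymx, hspec d P = hspec (fun i => d (s i)) Q &
    forall i j : 'I_n, (i <= j)%N -> d (s j) <= d (s i)].
Proof.
move=> uP; pose t := [tuple d i | i < n].
have pt : perm_eq (sort_tuple >=%R t) t by rewrite /= perm_sort.
have /tuple_permP[s ts] := pt.
exists s, (perm_mx s *m P); split.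
- exact: mul_unitarymx (unitary_perm_mx s) uP.
- rewrite !hspec.unlock -perm_mx_dg adjM !mulmxA.
  have uK := unitaryK (unitary_perm_mx s).
  by rewrite -!(mulmxA _ ((perm_mx s)^t*) (perm_mx s)) !uK !mulmx1.
- have dE i : d (s i) = nth 0 (sort >=%R t) i.
    rewrite [sort _ _]ts (nth_map i) ?size_enum_ord // nth_ord_enum.
    by rewrite tnth_mktuple.
  move=> i j ij; rewrite !dE.
  have tr : transitive (>=%R : rel R) by move=> x y z yx xz; exact: le_trans xz yx.
  have so : sorted >=%R (sort >=%R t) by apply: sort_sorted => x y; exact: le_total.
  have si (h : 'I_n) : nat_of_ord h \in [pred m | (m < size (sort >=%R t))%N].
    by rewrite inE size_sort size_tuple.
  have re : reflexive (>=%R : rel R) by move=> z; exact: lexx.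
  exact: (sorted_leq_nth tr re 0 so _ _ (si i) (si j) ij).
Qed.

(* Robin Hood transfers: where [x] first exceeds [y], say at [k], some earlier [j] has
   [x j < y j]; moving mass from [j] to [k] averages [y] with a transposition of it and
   makes [x] and [y] agree at one more index. *)
Lemma majorization_convex n (F : ('I_n -> R) -> R) :
  (forall x y, (forall i, x i <= y i) -> F x <= F y) ->
  (forall y j k l, 0 <= l <= 1 ->
     F (fun i => l * y i + (1 - l) * y (tperm j k i)) <= F y) ->
  forall x y : 'I_n -> R,
  (forall i j : 'I_n, (i <= j)%N -> x j <= x i) ->
  (forall m, (m <= n)%N ->
     \sum_(i < n | (i < m)%N) x i <= \sum_(i < n | (i < m)%N) y i) ->
  F x <= F y.
Proof.
move=> Fmono Fswap x y xI.
move: {2}(#|[set i | x i != y i]|.+1) (ltnSn #|[set i | x i != y i]|) => c.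
elim: c y => // c IH y cy sxy.
case: (boolP [forall i, x i <= y i]) => [/forallP h|]; first exact: Fmono.
rewrite negb_forall => /existsP[k0 hk0].
pose k := [arg min_(i < k0 | ~~ (x i <= y i)) i].
have [xk kmin] : y k < x k /\ forall i : 'I_n, (i < k)%N -> x i <= y i.
  rewrite /k; case: arg_minnP => // i hi imin; split; first by rewrite ltNge.
  move=> j ji; rewrite leNgt; apply/negP => yx.
  by have := imin j; rewrite -ltNge yx leqNgt ji => /(_ isT).
(* Otherwise [y <= x] before [k] and [y k < x k], against the partial sums up to and including
   [k]. *)
have [j jk xj] : exists2 j : 'I_n, (j < k)%N & x j < y j.
  case: (boolP [exists j : 'I_n, (j < k)%N && (x j < y j)]) => [/existsP[j /andP[jk xj]]|].
    by exists j.
  rewrite negb_exists => /forallP h; exfalso.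
  have := sxy k.+1 (ltn_ord k); rewrite leNgt => /negP; apply.
  have E (z : 'I_n -> R) : \sum_(i < n | (i < k.+1)%N) z i = z k + \sum_(i < n | (i < k)%N) z i.
    rewrite (bigD1 k) //=; congr (_ + _); apply: eq_bigl => i.
    by rewrite ltnS -val_eqE /= andbC ltn_neqAle.
  rewrite !E; apply: ltr_leD => //; apply: ler_sum => i ik.
  by rewrite leNgt; have := h i; rewrite ik.
(* The largest transfer keeping [x j <= y' j] and [y' k <= x k]; one of the two becomes an
   equality. *)
pose e := Order.min (y j - x j) (x k - y k).
have e0 : 0 < e by rewrite lt_min !subr_gt0 xj.
have ej : e <= y j - x j by rewrite ge_min lexx.
have ek : e <= x k - y k by rewrite ge_min lexx orbT.
have xkj : x k <= x j by apply: xI; exact: ltnW.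
have njk : (j == k) = false by rewrite -val_eqE /= ltn_eqF.
have nkj : (k == j) = false by rewrite eq_sym.
pose y' i := if i == j then y j - e else if i == k then y k + e else y i.
have y'j : y' j = y j - e by rewrite /y' eqxx.
have y'k : y' k = y k + e by rewrite /y' nkj eqxx.
have y'i i : i != j -> i != k -> y' i = y i by rewrite /y' => /negbTE -> /negbTE ->.
have D0 : 0 < y j - y k by lra.
apply: (@le_trans _ _ (F y')); last first.
  (* The weight with which averaging [y] and its transposition moves exactly [e] from [j] to [k]. *)
  pose l := 1 - e / (y j - y k).
  have l01 : 0 <= l <= 1.
    rewrite /l subr_ge0 ler_pdivrMr // mul1r; apply/andP; split; first by lra.
    by rewrite lerBlDr lerDl divr_ge0 // ltW.
  apply: le_trans (Fswap y j k l l01); apply: Fmono => i.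
  have D0' : y j - y k != 0 by rewrite gt_eqF.
  rewrite le_eqVlt; apply/orP; left; apply/eqP; rewrite /l.
  case: (eqVneq i j) => [->|ij]; first by rewrite y'j tpermL; field.
  case: (eqVneq i k) => [->|ik]; first by rewrite y'k tpermR; field.
  by rewrite y'i // tpermD 1?eq_sym //; field.
apply: IH.
  rewrite -ltnS; apply: leq_trans cy; rewrite ltnS; apply: proper_card; apply/properP; split.
    apply/subsetP => i; rewrite !inE.
    case: (eqVneq i j) => [-> _|ij]; first by rewrite lt_eqF.
    case: (eqVneq i k) => [-> _|ik]; first by rewrite gt_eqF.
    by rewrite y'i.
  case: (leP (y j - x j) (x k - y k)) => h.
    exists j; first by rewrite inE lt_eqF.
    by rewrite inE negbK y'j /e min_l // opprB addrC subrK.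
  exists k; first by rewrite inE gt_eqF.
  by rewrite inE negbK y'k /e min_r ?ltW // addrC subrK.
(* Up to [k] the bound holds termwise by minimality of [k]; beyond it both [j] and [k] are counted
   and the transfer preserves the sum. *)
move=> m mn; case: (leqP m k) => mk.
  apply: ler_sum => i im; have ik : (i < k)%N := leq_trans im mk.
  case: (eqVneq i j) => [->|ij]; first by rewrite y'j; lra.
  by rewrite y'i // ?kmin // -val_eqE /= ltn_eqF.
have jm : (j < m)%N := ltn_trans jk mk.
apply: le_trans (sxy m mn) _; rewrite le_eqVlt; apply/orP; left; apply/eqP.
rewrite (bigD1 j) //= [RHS](bigD1 j) //= (bigD1 k) ?nkj ?mk //= [in RHS](bigD1 k) ?nkj ?mk //=.
rewrite [in RHS](eq_bigr y) => [|i /andP[/andP[_ ij] ik]]; last exact: y'i.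
by rewrite y'j y'k; ring.
Qed.

Definition ui_seminorm n (N : 'M[CC]_n -> R) :=
  [/\ forall c A, 0 <= c -> N (c%:C *: A) = c * N A,
      forall A B, N (A + B) <= N A + N B &
      forall A U V, U \is unitarymx -> V \is unitarymx -> N (U *m A *m V) = N A].

Lemma dg_comb n (a b : R) (x y : 'I_n -> R) :
  dg (fun i => a * x i + b * y i) = a%:C *: dg x + b%:C *: dg y.
Proof.
apply/matrixP => i j; rewrite [RHS]mxE [X in _ = X + _]mxE [X in _ = _ + X]mxE !dgE.
by rewrite rmorphD !rmorphM mulrnDl !mulrnAr.
Qed.

Lemma ui_hspec n N (d : 'I_n -> R) P : ui_seminorm N -> P \is unitarymx ->
  N (hspec d P) = N (dg d).
Proof.
move=> [_ _ NU] uP; rewrite hspec.unlock.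
by have uP' : P^t* \is unitarymx; [rewrite trmxC_unitary | exact: NU uP' uP].
Qed.

Lemma ui_dg_convex n N (x y : 'I_n -> R) a b : ui_seminorm N -> 0 <= a -> 0 <= b ->
  N (dg (fun i => a * x i + b * y i)) <= a * N (dg x) + b * N (dg y).
Proof.
by move=> [NZ ND _] a0 b0; rewrite dg_comb -!NZ.
Qed.

Lemma ui_dg_perm n N (x : 'I_n -> R) (s : 'S_n) : ui_seminorm N ->
  N (dg (fun i => x (s i))) = N (dg x).
Proof.
move=> [_ _ NU]; rewrite -perm_mx_dg; apply: NU; first exact: unitary_perm_mx.
rewrite trmxC_unitary; exact: unitary_perm_mx.
Qed.

Lemma eq_dg n (d e : 'I_n -> R) : d =1 e -> dg d = dg e.
Proof. by move=> de; apply/matrixP => i j; rewrite !dgE de. Qed.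

(** The smaller diagonal is a convex combination of [y] and [y] with its [k]-th sign flipped, which
    has the same norm; the weights are [(1 + q) / 2] and [(1 - q) / 2] for [q = c / y k]. *)
Lemma ui_dg_decr1 n N (y : 'I_n -> R) (k : 'I_n) (c : R) : ui_seminorm N -> 0 <= c <= y k ->
  N (dg (fun i => if i == k then c else y i)) <= N (dg y).
Proof.
move=> uN /andP[c0 cy].
case: (eqVneq (y k) 0) => [yk|yk].
  have cE : c = 0 by apply/eqP; rewrite eq_le c0 -yk cy.
  rewrite (@eq_dg _ _ y) ?lexx // => i; rewrite cE; case: eqP => // ->; by rewrite yk.
have yk0 : 0 < y k by rewrite lt_neqAle eq_sym yk (le_trans c0).
pose sg i : R := if i == k then -1 else 1.
have usg : dg sg \is unitarymx.
  apply/unitarymxP; rewrite dg_adj dgM -(dg1 n); apply: eq_dg => i.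
  by rewrite /sg; case: eqP => _; rewrite ?mulrNN mulr1.
have flip : N (dg (fun i => sg i * y i)) = N (dg y).
  have [_ _ NU] := uN; rewrite -dgM -[X in N X]mulmx1; apply: (NU _ _ _ usg).
  by apply/unitarymxP; rewrite mul1mx adj1.
pose q := c / y k.
have q0 : 0 <= q by rewrite divr_ge0 // ltW.
have q1 : q <= 1 by rewrite ler_pdivrMr // mul1r.
have a0 : 0 <= (1 + q) / 2 by lra.
have b0 : 0 <= (1 - q) / 2 by lra.
have := ui_dg_convex y (fun i => sg i * y i) uN a0 b0; rewrite flip -mulrDl.
rewrite (_ : (1 + q) / 2 + (1 - q) / 2 = 1); last by field.
rewrite mul1r; congr (_ <= _); congr (N _); apply: eq_dg => i.
by rewrite /sg /q; case: eqP => [->|_]; field.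
Qed.

Lemma ui_dg_mono n N (x y : 'I_n -> R) : ui_seminorm N ->
  (forall i, 0 <= x i <= y i) -> N (dg x) <= N (dg y).
Proof.
move=> uN xy.
suff h m : (m <= n)%N -> N (dg (fun i => if (i < m)%N then x i else y i)) <= N (dg y).
  have := h n (leqnn n); rewrite (@eq_dg _ _ x) // => i.
  by rewrite ltn_ord.
elim: m => [_|m IH mn]; first by rewrite (@eq_dg _ _ y).
apply: le_trans (IH (ltnW mn)).
pose z (i : 'I_n) := if (i < m)%N then x i else y i.
have := @ui_dg_decr1 n N z (Ordinal mn) (x (Ordinal mn)) uN.
rewrite {1}/z /= ltnn => /(_ (xy _)).
congr (_ <= _); congr (N _); apply: eq_dg => i.
rewrite ltnS leq_eqVlt -val_eqE /= /z.
by case: eqP => [im|] //=; congr x; exact: val_inj.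
Qed.

(** The tangent of [exp] at the mean [m] lies below the graph; averaging it at [u] and [v] gives
    back [exp m]. *)
Lemma exp_convex (l u v : R) : 0 <= l <= 1 ->
  exp (l * u + (1 - l) * v) <= l * exp u + (1 - l) * exp v.
Proof.
move=> /andP[l0 l1]; set m := _ + _.
have tangent w : exp m * (1 + (w - m)) <= exp w.
  have -> : exp w = exp m * exp (w - m)
    by rewrite -RmultE -exp_plus; congr exp; rewrite RplusE; ring.
  rewrite ler_pM2l; last exact/RltP/exp_pos.
  exact/RleP/exp_ineq1_le.
have <- : l * (exp m * (1 + (u - m))) + (1 - l) * (exp m * (1 + (v - m))) = exp m.
  have mE : m = l * u + (1 - l) * v by [].
  move: (exp m) => q; rewrite mE; ring.
by apply: lerD; apply: ler_wpM2l => //; rewrite ?subr_ge0.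
Qed.

Theorem ui_exp_majorization n N (a b : 'I_n -> R) : ui_seminorm N ->
  (forall i j : 'I_n, (i <= j)%N -> a j <= a i) ->
  (forall m, (m <= n)%N ->
     \sum_(i < n | (i < m)%N) a i <= \sum_(i < n | (i < m)%N) b i) ->
  N (dg (fun i => exp (a i))) <= N (dg (fun i => exp (b i))).
Proof.
move=> uN; have exp0 x : 0 <= exp x by apply/ltW/RltP/exp_pos.
apply: (@majorization_convex n (fun x => N (dg (fun i => exp (x i))))) => [x y xy|y j k l l01].
  by apply: ui_dg_mono => // i; rewrite exp0 exp_ler.
apply: (@le_trans _ _ (N (dg (fun i => l * exp (y i) + (1 - l) * exp (y (tperm j k i)))))).
  by apply: ui_dg_mono => // i; rewrite exp0 exp_convex.
have /andP[l0 l1] := l01.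
apply: le_trans (ui_dg_convex _ _ uN l0 _) _; first by rewrite subr_ge0.
rewrite (ui_dg_perm (fun i => exp (y i))) // -mulrDl addrC subrK mul1r; exact: lexx.
Qed.

(** * The norm inequality *)

Definition toC (z : C) : CC := Complex (Cre z) (Cim z).
Definition ofC (z : CC) : C := mkC (Re z) (Im z).
Definition toM n (A : Mat n) : 'M[CC]_n := \matrix_(i, j) toC (A i j).
Definition ofM n (A : 'M[CC]_n) : Mat n := fun i j => ofC (A i j).

Lemma toMK n (A : Mat n) : ofM (toM A) = A.
Proof.
apply: functional_extensionality => i; apply: functional_extensionality => j.
by rewrite /ofM mxE; case: (A i j).
Qed.

Lemma ofMK n (A : 'M[CC]_n) : toM (ofM A) = A.
Proof. by apply/matrixP => i j; rewrite mxE /ofM; case: (A i j). Qed.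

Lemma toM_inj n : injective (@toM n).
Proof. exact: can_inj (@toMK n). Qed.

Lemma toM_madd n (A B : Mat n) : toM (madd A B) = toM A + toM B.
Proof. by apply/matrixP => i j; rewrite !mxE. Qed.

Lemma toC_sum (I : Type) (r : seq I) (F : I -> C) :
  toC (\big[Cadd/C0]_(i <- r) F i) = \sum_(i <- r) toC (F i).
Proof. exact: (big_morph toC (id1 := 0) (op1 := +%R)). Qed.

Lemma toM_mmul n (A B : Mat n) : toM (mmul A B) = toM A *m toM B.
Proof.
apply/matrixP => i j; rewrite !mxE toC_sum; apply: eq_bigr => l _; rewrite !mxE.
by [].
Qed.

Lemma toM_adj n (A : Mat n) : toM (adj A) = (toM A)^t*.
Proof. by apply/matrixP => i j; rewrite !mxE. Qed.

Lemma toM_mid n : toM (@mid n) = 1%:M.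
Proof. by apply/matrixP => i j; rewrite !mxE /mid; case: eqP. Qed.

Lemma toM_mdiag n (d : 'I_n -> R) : toM (mdiag d) = dg d.
Proof. by apply/matrixP => i j; rewrite dgE mxE /mdiag; case: eqP. Qed.

Lemma toM_cscale n c (A : Mat n) : toM (cscale c A) = toC c *: toM A.
Proof. by apply/matrixP => i j; rewrite !mxE. Qed.

Lemma toM_mscale n c (A : Mat n) : toM (mscale c A) = c%:C *: toM A.
Proof. exact: toM_cscale. Qed.

Lemma toM_unitary n (U : Mat n) : unitary U <-> toM U \is unitarymx.
Proof.
rewrite /unitary; split => [/(congr1 (@toM n))|/unitaryK h].
  by rewrite toM_mmul toM_adj toM_mid => /mulmx1C h; apply/unitarymxP.
by apply: toM_inj; rewrite toM_mmul toM_adj toM_mid.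
Qed.

Lemma toM_spectral n (A : Mat n) p : spectral_decomp A p <->
  (toM p.1)^t* \is unitarymx /\ toM A = hspec p.2 ((toM p.1)^t*).
Proof.
rewrite /spectral_decomp toM_unitary trmxC_unitary hspec.unlock trmxCK.
rewrite -toM_mdiag -toM_adj -!toM_mmul.
by split=> [] [uU h]; split=> //; [rewrite h | exact: toM_inj].
Qed.

(** The decomposition picked by [epsilon] is some spectral decomposition, one existing by the
    spectral theorem, and [fcE] makes the choice immaterial. *)
Lemma toM_mfun n f (A : Mat n) : herm (toM A) -> toM (mfun f A) = fc f (toM A).
Proof.
move=> hA; have /toM_spectral[uU AE] : spectral_decomp A (some_decomp A).
  apply: epsilon_spec;
  exists (ofM ((spectralmx (toM A))^t*), fun i => Re (spectral_diag (toM A) 0 i)).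
  apply/toM_spectral; rewrite /= ofMK trmxCK; split; first exact: spectral_unitarymx.
  exact: herm_spec.
rewrite AE (fcE _ _ uU) hspec.unlock trmxCK /mfun !toM_mmul toM_adj toM_mdiag.
by [].
Qed.

Lemma ui_norm_seminorm n (N : Mat n -> R) : unitarily_invariant_norm N ->
  ui_seminorm (fun A => N (ofM A)).
Proof.
move=> [[_ [_ [NZ ND]]] NU]; split=> [c A c0|A B|A U V uU uV].
- have -> : ofM (c%:C *: A) = cscale (RtoC c) (ofM A).
    by apply: toM_inj; rewrite toM_cscale !ofMK.
  rewrite NZ; congr (_ * _); rewrite /Cmod /= !Rmult_0_l Rplus_0_r Rmult_1_r.
  by apply: sqrt_square; exact/RleP.
- have -> : ofM (A + B) = madd (ofM A) (ofM B).
    by apply: toM_inj; rewrite toM_madd !ofMK.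
  by apply/RleP; exact: ND.
- have -> : ofM (U *m A *m V) = mmul (mmul (ofM U) (ofM A)) (ofM V).
    by apply: toM_inj; rewrite !toM_mmul !ofMK.
  by apply: NU; apply/toM_unitary; rewrite ofMK; [exact: uU | exact: uV].
Qed.

Lemma herm_toM n (A : Mat n) : hermitian A -> herm (toM A).
Proof. by move=> hA; rewrite /herm -toM_adj hA. Qed.

Lemma herm_scale n c (A : 'M[CC]_n) : herm A -> herm (c%:C *: A).
Proof. by move=> hA; rewrite (herm_spec hA) hspecZ; exact: hspec_adj. Qed.

Lemma herm_add n (A B : 'M[CC]_n) : herm A -> herm B -> herm (A + B).
Proof. by move=> hA hB; rewrite /herm adjD hA hB. Qed.

Lemma fc_exp_posdef n (A : 'M[CC]_n) : posdef (fc exp A).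
Proof.
have [d [P [uP E]]] := fcP A; rewrite E; apply: (posdef_hspec uP) => i.
exact/RltP/exp_pos.
Qed.

Lemma fc_ln_exp n (A : 'M[CC]_n) : herm A -> fc ln (fc exp A) = A.
Proof.
move=> /herm_spec hA; rewrite {2}hA fc_comp fc.unlock.
by apply: eq_hspec => i; rewrite ln_exp.
Qed.

Lemma fc_ln_inv n (A : 'M[CC]_n) : fc ln (pw A (- 1)) = (- 1)%:C *: fc ln A.
Proof.
rewrite /pw fc_comp; have [d [P [uP E]]] := fcP A; rewrite !E hspecZ.
by apply: eq_hspec => i; rewrite ln_RpowerE.
Qed.

Lemma pwN1_unique n (A B : 'M[CC]_n) : posdef A -> A *m B = 1%:M -> pw A (- 1) = B.
Proof.
move=> pA AB; have := pwVK A 1; rewrite (pw1 pA) => h.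
by rewrite -[LHS]mulmx1 -AB mulmxA h mul1mx.
Qed.

(** * Weighted geometric means *)

Definition wgmean n (X Y : 'M[CC]_n) t :=
  pw X 2^-1 *m pw (pw X (- 2^-1) *m Y *m pw X (- 2^-1)) t *m pw X 2^-1.

(** The inverse of [X^(-1/2) Y X^(-1/2)] is [X^(1/2) Y^-1 X^(1/2)], and [J^t] is the power [-t] of
    [J^-1]. *)
Lemma wgmean_npos n (X Y : 'M[CC]_n) t : posdef X -> posdef Y ->
  wgmean X Y t = renyi X (pw Y (- 1)) (- t).
Proof.
move=> pX pY; rewrite /wgmean /renyi.
set J := pw X (- 2^-1) *m Y *m pw X (- 2^-1).
have pJ : posdef J := posdef_pw_conj X (- 2^-1) pY.
have <- : pw J (- 1) = pw X 2^-1 *m pw Y (- 1) *m pw X 2^-1.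
  apply: pwN1_unique => //; rewrite /J !mulmxA -(mulmxA _ (pw X _) (pw X _)) pwVK mulmx1.
  rewrite -{1}(pw1 pY) -(mulmxA _ (pw Y _) (pw Y _)) pwK mulmx1.
  exact: pwVK.
by rewrite pw_pw mulrNN mul1r.
Qed.

(* [X #_t Y = Y #_(1-t) X], through [J = Z Z^*] with [Z = X^(-1/2) Y^(1/2)]. *)
Lemma wgmean_ge1 n (X Y : 'M[CC]_n) t : posdef X -> posdef Y ->
  wgmean X Y t = renyi Y (pw X (- 1)) (t - 1).
Proof.
move=> pX pY; rewrite /wgmean /renyi.
set J := pw X (- 2^-1) *m Y *m pw X (- 2^-1); set L := pw Y 2^-1 *m pw X (- 1) *m pw Y 2^-1.
have pJ : posdef J := posdef_pw_conj X (- 2^-1) pY.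
have pL : posdef L := posdef_pw_conj Y 2^-1 (posdef_pw X (- 1)).
pose Z := pw X (- 2^-1) *m pw Y 2^-1.
have JE : J = Z *m Z^t*.
  by rewrite /Z adjM !herm_pw !mulmxA -(mulmxA (pw X _)) pwD halfDhalf (pw1 pY).
have LE : L = Z^t* *m Z.
  rewrite /Z adjM !herm_pw !mulmxA -(mulmxA (pw Y _)) pwD /L.
  by rewrite -opprD halfDhalf.
have XZ : pw X 2^-1 *m Z = pw Y 2^-1 by rewrite /Z mulmxA pwK mul1mx.
clearbody Z.
have ZX : Z^t* *m pw X 2^-1 = pw Y 2^-1 by rewrite -[RHS]herm_pw -XZ adjM herm_pw.
(* The outer factors satisfy [X^(1/2) Z = Y^(1/2)], so it suffices to rewrite [J^t = J^(t-1) Z Z^*]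
   as [Z L^(t-1) Z^*]. *)
have JZ : pw J (t - 1) *m Z = Z *m pw L (t - 1).
  by apply: (fc_intertwine _ pJ.1 pL.1); rewrite JE LE !mulmxA.
have -> : pw J t = Z *m pw L (t - 1) *m Z^t*.
  by rewrite -JZ -mulmxA -JE -{3}(pw1 pJ) pwD subrK.
by rewrite !mulmxA XZ -mulmxA ZX.
Qed.

Lemma posdef_renyi n (A B : 'M[CC]_n) s : posdef (renyi A B s).
Proof. by apply: posdef_pw_conj; exact: posdef_pw. Qed.

(** Unitary invariance reduces both sides to diagonal matrices of exponentials with sorted
    exponents; the partial sums for [r S] are bounded by those for the logarithm of [renyi A B s],
    and dividing by [r] gives the exponents needed. *)
Lemma ui_renyi n N (A B S : 'M[CC]_n) (r s : R) : ui_seminorm N -> 0 < r ->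
  posdef A -> posdef B -> 0 <= s -> herm S ->
  s%:C *: fc ln B + (1 + s)%:C *: fc ln A = r%:C *: S ->
  N (fc exp S) <= N (pw (renyi A B s) r^-1).
Proof.
move=> uN r0 pA pB s0 hS SE.
have [e [P [uP ep RE]]] := posdefP (posdef_renyi A B s).
have [p [U [uU PU bI]]] := hspec_sorted (fun i => ln (e i)) uP.
have RU : renyi A B s = hspec (fun i => exp (ln (e (p i)))) U.
  have := congr1 (fc exp) PU; rewrite (fcE _ _ uP) (fcE _ _ uU) => <-; rewrite RE.
  by apply: eq_hspec => i; rewrite exp_ln //; exact/RltP.
have [q [W [uW SW aI]]] := hspec_sorted (fun i => Re (spectral_diag S 0 i)) (spectral_unitarymx S).
rewrite -(herm_spec hS) in SW.
have ln0 : r != 0 by rewrite gt_eqF.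
rewrite {1}SW (fcE _ _ uW) ui_hspec // RU /pw (fcE _ _ uU) ui_hspec //.
rewrite (@eq_dg _ (fun i => Rpower _ _) (fun i => exp (r^-1 * ln (e (p i))))); last first.
  by move=> i; rewrite /Rpower ln_exp.
apply: ui_exp_majorization => // m mn.
rewrite -mulr_sumr ler_pdivlMl // mulr_sumr.
apply: (renyi_log_majorization pA pB s0 mn uU RU bI uW).
by rewrite SE {1}SW hspecZ.
Qed.

Lemma toM_mpow n (A : Mat n) x : herm (toM A) -> toM (mpow A x) = pw (toM A) x.
Proof. exact: toM_mfun. Qed.

Lemma toM_gmean n (X Y : Mat n) t : posdef (toM X) -> posdef (toM Y) ->
  toM (gmean X Y t) = wgmean (toM X) (toM Y) t.
Proof.
move=> pX pY; have half : Rdiv 1 2 = 2^-1 by rewrite RdivE mul1r.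
have JE : toM (mmul (mmul (mpow X (Ropp (Rdiv 1 2))) Y) (mpow X (Ropp (Rdiv 1 2)))) =
    pw (toM X) (- 2^-1) *m toM Y *m pw (toM X) (- 2^-1).
  by rewrite 2!toM_mmul (toM_mpow _ pX.1) half.
have hJ := (posdef_pw_conj (toM X) (- 2^-1) pY).1; rewrite -JE in hJ.
by rewrite /gmean 2!toM_mmul (toM_mpow _ pX.1) (toM_mpow _ hJ) JE half.
Qed.

Local Open Scope R_scope.
#[local] Bind Scope R_scope with R.

Theorem theorem1 (n : nat) (H K : Mat n) (r t : R) (N : Mat n -> R) :
  hermitian H -> hermitian K -> 0 < r -> (t <= 0 \/ 1 <= t) ->
  unitarily_invariant_norm N ->
  N (mexp (madd (mscale (1 - t) H) (mscale t K)))
  <= N (mpow (gmean (mexp (mscale r H)) (mexp (mscale r K)) t) (1 / r)).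
Proof.
move=> /herm_toM hH /herm_toM hK /RltP r0 ht /ui_norm_seminorm uN.
set S := madd _ _; set X := mexp (mscale r H); set Y := mexp (mscale r K).
Local Close Scope R_scope.
have hS : herm (toM S).
  by rewrite toM_madd !toM_mscale; apply: herm_add; exact: herm_scale.
have hrH : herm (toM (mscale r H)) by rewrite toM_mscale; exact: herm_scale.
have hrK : herm (toM (mscale r K)) by rewrite toM_mscale; exact: herm_scale.
have pX : posdef (toM X) by rewrite /X /mexp toM_mfun //; exact: fc_exp_posdef.
have pY : posdef (toM Y) by rewrite /Y /mexp toM_mfun //; exact: fc_exp_posdef.
have lnX : fc ln (toM X) = r%:C *: toM H.
  by rewrite /X /mexp toM_mfun // fc_ln_exp // toM_mscale.
have lnY : fc ln (toM Y) = r%:C *: toM K.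
  by rewrite /Y /mexp toM_mfun // fc_ln_exp // toM_mscale.
have GE := toM_gmean t pX pY.
have hG : herm (toM (gmean X Y t)).
  rewrite GE; exact: (posdef_pw_conj _ _ (posdef_pw _ _)).1.
apply/RleP; rewrite -[mexp S]toMK -[mpow _ _]toMK toM_mfun // toM_mpow // GE.
rewrite RdivE mul1r.
have SE : toM S = (1 - t)%:C *: toM H + t%:C *: toM K by rewrite toM_madd !toM_mscale.
case: ht => /RleP ht.
  rewrite wgmean_npos //; apply: (ui_renyi uN r0 pX (posdef_pw _ _) _ hS).
    by rewrite oppr_ge0.
  rewrite fc_ln_inv lnX lnY SE scalerDr !scalerA -!rmorphM addrC.
  by congr (_%:C *: _ + _%:C *: _); ring.
rewrite wgmean_ge1 //; apply: (ui_renyi uN r0 pY (posdef_pw _ _) _ hS).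
  by rewrite subr_ge0.
rewrite fc_ln_inv lnX lnY SE scalerDr !scalerA -!rmorphM.
by congr (_%:C *: _ + _%:C *: _); ring.
Qed.
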